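(* Let $\overline{B}_n=2^{-n}\binom{2n}{n}$, $n=0,1,2,\ldots$ (so $\overline{B}_0=1$). Then: (a) $\{\overline{B}_n\}_{n=0}^{\infty}$ is an infinitely divisible Stieltjes moment sequence. (b) If a random variable $Y$ has moment sequence $\{\overline{B}_n\}_{n=0}^\infty$, then $Y$ has density $$g(y)=\frac{1}{\pi}\frac{1}{\sqrt{y(2-y)}},\quad y\in(0,2),$$ and moment generating function $E[e^{tY}]=e^{t}I_0(t)$ for all $t\in\mathbb{R}$, where $I_0(t)=\sum_{k=0}^\infty (t/2)^{2k}/(k!)^2$ is the modified Bessel function of the first kind of order $0$. (c) For each real $c>0$, the power sequence $\{\overline{B}_n^c\}_{n=0}^\infty$ is Stieltjes determinate. (d) For each real $c>0$, the (unique) measure $\mu_c$ on $[0,\infty)$ with moment sequence $\{\overline{B}_n^c\}_{n=0}^\infty$ has Mellin transform $$\int_0^\infty t^s\,d\mu_c(t)=\left(\frac{2^{s}}{\sqrt{\pi}}\cdot\frac{\Gamma(s+1/2)}{\Gamma(s+1)}\right)^c=\left(\frac{1}{2^s}\cdot\frac{\Gamma(2s+1)}{(\Gamma(s+1))^2}\right)^c,\quad s\ge0.$$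
   Context: A real sequence $\{m_n\}_{n=0}^\infty$ is a Stieltjes moment sequence if there is a nonnegative measure $\mu$ on $[0,\infty)$ with $m_n=\int_{[0,\infty)}x^n\,d\mu(x)$ for all $n\ge0$; it is Stieltjes determinate if such $\mu$ is unique. A Stieltjes moment sequence $\{m_n\}$ is infinitely divisible (in the sense of Tyan) if $\{m_n^c\}_{n=0}^\infty$ is a Stieltjes moment sequence for every real $c>0$. *)

(* Defs.v *)
From HB Require Import structures.
From mathcomp Require Import all_boot all_order all_algebra.
From mathcomp Require Import all_classical all_reals all_analysis.

Set Implicit Arguments.
Unset Strict Implicit.
Unset Printing Implicit Defensive.

Import Order.TTheory GRing.Theory Num.Theory.
Import numFieldNormedType.Exports.

Local Open Scope classical_set_scope.
Local Open Scope ring_scope.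

(* A measure on [0, +oo) is encoded as a Borel measure on R that does not
   charge the complement of [0, +oo). *)
Definition has_stieltjes_moments (R : realType)
    (mu : {measure set (measurableTypeR R) -> \bar R}) (m : nat -> R) : Prop :=
  mu (~` `[0, +oo[) = 0%E /\
  forall n : nat, (\int[mu]_(x in `[0%R, +oo[) (x ^+ n)%:E = (m n)%:E)%E.

Definition stieltjes_moment_sequence (R : realType) (m : nat -> R) : Prop :=
  exists mu : {measure set (measurableTypeR R) -> \bar R},
    has_stieltjes_moments mu m.

Definition stieltjes_determinate (R : realType) (m : nat -> R) : Prop :=
  stieltjes_moment_sequence m /\
  forall mu nu : {measure set (measurableTypeR R) -> \bar R},
    has_stieltjes_moments mu m -> has_stieltjes_moments nu m ->
    forall A : set (measurableTypeR R), measurable A -> mu A = nu A.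

Definition infinitely_divisible_stieltjes (R : realType) (m : nat -> R) : Prop :=
  stieltjes_moment_sequence m /\
  forall c : R, 0 < c -> stieltjes_moment_sequence (fun n => m n `^ c).

Definition has_moment_sequence (d : measure_display) (T : measurableType d)
    (R : realType) (P : probability T R) (Y : {RV P >-> R}) (m : nat -> R) :
    Prop :=
  forall n : nat, ('E_P[fun w => (Y w ^+ n)%R] = (m n)%:E)%E.

Definition has_density (d : measure_display) (T : measurableType d)
    (R : realType) (P : probability T R) (Y : {RV P >-> R}) (f : R -> R) :
    Prop :=
  [/\ measurable_fun [set: R] f,
      forall y : R, 0 <= f y &
      forall A : set (measurableTypeR R), measurable A ->
        distribution P Y A = (\int[lebesgue_measure]_(y in A) (f y)%:E)%E].

(* Euler's integral, which converges for x > 0. *)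
Definition Gamma (R : realType) (x : R) : R :=
  \int[lebesgue_measure]_(t in `]0, +oo[) (t `^ (x - 1) * expR (- t)).

Definition besselI0 (R : realType) (t : R) : R :=
  limn (series (fun k : nat => (t / 2) ^+ (2 * k) / (k`!)%:R ^+ 2)).

Definition Bbar (R : realType) (n : nat) : R := 2 ^- n * 'C(2 * n, n)%:R.

Lemma Bbar0 (R : realType) : Bbar R 0 = 1.
Proof. by rewrite /Bbar muln0 bin0 expr0 invr1 mulr1. Qed.

Definition arcsine_density (R : realType) (y : R) : R :=
  if 0 < y < 2 then 1 / pi * (1 / Num.sqrt (y * (2 - y))) else 0.

(* Main.v *)
Require Import Defs.
From HB Require Import structures.
From mathcomp Require Import all_boot all_order all_algebra.
From mathcomp Require Import all_classical all_reals all_analysis.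
From mathcomp Require Import measurable_realfun ring lra.

(** (d), existence: with q(s) = (Gamma(s+1/2) / Gamma(s+1))^2 (s + 1/2), the
    functional equation gives q(s+1) = q(s) (1 - 1 / (4 (s+1)^2)) and log-convexity
    of Gamma gives q(s) -> 1, so
    ln q(s) = sum_k - ln (1 - 1 / (4 (s+k+1)^2)).
    Laplace transforms of measures are closed under products, under countable sums,
    and hence under exp and u |-> - ln (1 - u); they contain (s + a)^(-p).  Therefore
    (2^s / sqrt pi * Gamma(s+1/2) / Gamma(s+1))^c is a Laplace transform for every
    c > 0, and its image under x |-> e^(-x) is a measure on [0, +oo) with the
    required Mellin transform; at integers this is the moment sequence of (a).

    (c), uniqueness: moments bounded by K^n force the support into [-K, K], and
    there the polynomials (1 - x^n)^(n 2^n) (x in [0, 1] after an affine change of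
    variable) converge boundedly to the indicator of [0, 1/2), so that moments
    determine the measure of every ray.

    (b): the substitution y = 1 - cos theta turns integrals against the arcsine
    density into averages over [0, pi], which reduction formulas evaluate. *)

Set Implicit Arguments.
Unset Strict Implicit.
Unset Printing Implicit Defensive.

Import Order.TTheory GRing.Theory Num.Theory.
Import numFieldNormedType.Exports.

Local Open Scope classical_set_scope.
Local Open Scope ring_scope.

(** * Improper integrals and substitution *)

(** Real exponents c are the obstacle: convolution powers of a representing measure reach only
    integer c. Under a logarithm, c becomes a nonnegative factor, which is harmless provided that
    the logarithm is itself the Laplace transform of a measure. The logarithm of Gamma(s+1/2) /
    Gamma(s+1) is not one, because it tends to -oo; the factor s + 1/2 in q(s) compensates this
    decay, leaving a logarithm that is nonnegative and tends to 0. The factor is restored afterwards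
    as (s + 1/2)^(-c/2), the transform of a multiple of a Gamma density. The exponential and
    logarithmic series involved have nonnegative coefficients only, so no signed measure arises and
    sums and integrals are exchanged by monotonicity. The second expression in (d) rests on
    Legendre's duplication formula, which comes from the functional equation and the same
    log-convexity bounds: a quotient of the two sides has period 1/2, and its asymptotics force it
    to be constant. *)

Lemma cvg_integral_itvcc (R : realType) (f : R -> R) (u v : R^nat) (D : set R) :
  measurable_fun setT f -> (forall x, D x -> 0 <= f x) ->
  {homo u : m n / (m <= n)%N >-> n <= m} ->
  {homo v : m n / (m <= n)%N >-> m <= n} ->
  D = \bigcup_n `[u n, v n]%classic ->
  (\int[lebesgue_measure]_(x in `[u n, v n]) (f x)%:E)%E @[n --> \oo] -->
  (\int[lebesgue_measure]_(x in D) (f x)%:E)%E.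
Proof.
move=> mf f0 du dv DE; rewrite DE.
apply: (@ge0_nondecreasing_set_cvg_integral _ (measurableTypeR R) R
  (fun n => `[u n, v n]%classic) (fun x => (f x)%:E) lebesgue_measure).
- move=> m n mn; apply/subsetPset => x /=; rewrite !in_itv/= => /andP[ux xv].
  by rewrite (le_trans (du _ _ mn))//= (le_trans xv)// dv.
- by move=> i.
- by move=> i; apply/measurable_EFinP; exact: measurable_funTS.
- by move=> i x Dx; rewrite lee_fin f0// DE; exists i.
Qed.

Lemma itvoy_bigcup (R : realType) (u v : R^nat) :
  (forall n, 0 < u n) -> u @ \oo --> 0 -> v @ \oo --> +oo ->
  `]0, +oo[%classic = \bigcup_n `[u n, v n]%classic.
Proof.
move=> u0 cu cv; apply/seteqP; split => x /=; rewrite in_itv/= andbT.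
  move=> x0.
  have /filter_ex[n [un vn]] : \forall n \near \oo, u n <= x /\ x <= v n.
    near=> n; split; near: n; first exact: (cvgr_le 0).
    by move/cvgryPge : cv; apply.
  by exists n => //=; rewrite in_itv/= un.
by move=> [n _] /=; rewrite in_itv/= => /andP[un _]; exact: lt_le_trans (u0 n) un.
Unshelve. all: by end_near. Qed.

(** The integrands may blow up at the ends of the interval, as t^(x-1) does at 0 and the arcsine
    density at 0 and 2. The substitution is therefore made on the segments of an exhaustion, and
    both sides pass to the limit by monotone convergence. *)
Lemma integral_substitution_open (R : realType) (F dF f : R -> R)
    (a b : R^nat) (D E : set R) :
  (forall n, a n <= b n) ->
  {homo a : m n / (m <= n)%N >-> n <= m} ->
  {homo b : m n / (m <= n)%N >-> m <= n} ->
  open E -> E = \bigcup_n `[a n, b n]%classic ->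
  D = \bigcup_n `[F (a n), F (b n)]%classic ->
  {in E &, {homo F : x y / x < y}} ->
  (forall x, E x -> is_derive x 1 F (dF x)) ->
  (forall x, E x -> 0 <= dF x) ->
  (forall x, E x -> {for x, continuous dF}) ->
  measurable_fun setT f -> measurable_fun setT (fun x => f (F x) * dF x) ->
  (forall y, D y -> 0 <= f y) ->
  (forall y, D y -> {for y, continuous f}) ->
  (\int[lebesgue_measure]_(y in D) (f y)%:E =
   \int[lebesgue_measure]_(x in E) (f (F x) * dF x)%:E)%E.
Proof.
move=> ab da db oE EE DE incF dFF dF0 cdF mf mg f0 cf.
have aE n x : a n <= x <= b n -> E x.
  by move=> abx; rewrite EE; exists n => //=; rewrite in_itv.
have incF' x y : E x -> E y -> x <= y -> F x <= F y.
  move=> Ex Ey; rewrite le_eqVlt => /predU1P[->//|xy].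
  by apply/ltW/incF => //; rewrite inE.
have Ea n : E (a n) by apply: (aE n); rewrite lexx ab.
have Eb n : E (b n) by apply: (aE n); rewrite lexx ab.
have F'E x : E x -> derive1 F x = dF x.
  by move=> Ex; rewrite derive1E; have := dFF _ Ex => ?; rewrite derive_val.
have cF' x : E x -> {for x, continuous (derive1 F)}.
  move=> Ex; rewrite /prop_for /continuous_at F'E//.
  apply: cvg_trans; last exact: (cdF _ Ex).
  (* [derive1 F] is known to equal [dF] on [E] only; openness of [E] makes them agree near x. *)
  have nE : \forall y \near nbhs x, E y by exact: open_nbhs_nbhs.
  by apply: near_eq_cvg; apply: filterS nE => y Ey; rewrite F'E.
have cF x : E x -> {for x, continuous F}.
  move=> Ex; apply/differentiable_continuous/derivable1_diffP.
  by have := dFF _ Ex => ?; exact: ex_derive.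
have FD x n : a n <= x <= b n -> D (F x).
  move=> abx; rewrite DE; exists n => //=; rewrite in_itv/=.
  have Ex := aE _ _ abx; move: abx => /andP[ax xb].
  by rewrite !incF'.
have h1 := @cvg_integral_itvcc R f (F \o a) (F \o b) D mf f0.
have h2 := @cvg_integral_itvcc R (fun x => f (F x) * dF x) a b E mg _ da db EE.
have {}h2 := h2 _.
have /h2 {}h2 : forall x, E x -> 0 <= f (F x) * dF x.
  move=> x Ex; rewrite mulr_ge0 ?dF0// f0//.
  by move: Ex; rewrite EE => -[n _] /=; rewrite in_itv => /FD.
have {}h1 := h1 _ _ DE.
have /h1 {}h1 : {homo F \o a : m n / (m <= n)%N >-> n <= m}.
  by move=> m n mn /=; apply: incF' => //; exact: da.
have /h1 {}h1 : {homo F \o b : m n / (m <= n)%N >-> m <= n}.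
  by move=> m n mn /=; apply: incF' => //; exact: db.
apply: (cvg_unique (@ereal_hausdorff R) h1) => /=; apply: (cvg_trans _ h2); apply: near_eq_cvg.
near=> n => /=; apply/esym.
rewrite (@integration_by_substitution_increasing _ F f)//.
- apply: eq_integral => x; rewrite inE/= in_itv/= => /aE Ex.
  by rewrite /= !fctE F'E.
- move=> x y; rewrite !in_itv/= => /aE Ex /aE Ey xy.
  by apply: incF => //; rewrite inE.
- move=> x; rewrite in_itv/= => /andP[ax xb]; apply: cF'; apply: (aE n).
  by rewrite !ltW.
- by apply/cvg_ex; exists (derive1 F (a n)); apply: cvg_at_right_filter; exact: cF'.
- by apply/cvg_ex; exists (derive1 F (b n)); apply: cvg_at_left_filter; exact: cF'.
- split.
  + move=> x; rewrite in_itv/= => /andP[ax xb].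
    have Ex : E x by apply: (aE n); rewrite !ltW.
    by have := dFF _ Ex => ?; exact: ex_derive.
  + by apply: cvg_at_right_filter; exact: cF.
  + by apply: cvg_at_left_filter; exact: cF.
- apply: continuous_in_subspaceT => y; rewrite inE/= in_itv/= => ?.
  by apply: cf; rewrite DE; exists n => //=; rewrite in_itv.
Unshelve. all: by end_near. Qed.

(** The shift by 2 makes even the first segment from 1/(n+2) to n+2 nondegenerate, as integration by
    parts requires. *)
Lemma cvg_invn2 (R : realType) : (n.+2%:R^-1 : R) @[n --> \oo] --> (0 : R).
Proof.
rewrite (cvg_shiftS (fun n => n.+1%:R^-1 : R)).
exact: cvg_harmonic.
Qed.

Lemma cvg_n2 (R : realType) : (n.+2%:R : R) @[n --> \oo] --> +oo.
Proof.
rewrite (cvg_shiftS (fun n => n.+1%:R : R)) (cvg_shiftS (fun n => n%:R : R)).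
exact: cvgr_idn.
Qed.

Lemma nincr_invn2 (R : realType) :
  {homo (fun n => n.+2%:R^-1 : R) : m n / (m <= n)%N >-> n <= m}.
Proof. by move=> m n mn; rewrite lef_pV2 ?posrE// ler_nat. Qed.

Lemma ndecr_n2 (R : realType) :
  {homo (fun n => n.+2%:R : R) : m n / (m <= n)%N >-> m <= n}.
Proof. by move=> m n mn; rewrite ler_nat. Qed.

Lemma invn2_le_n2 (R : realType) n : n.+2%:R^-1 <= n.+2%:R :> R.
Proof. by rewrite (@le_trans _ _ 1)// ?invf_le1 ?ler1n. Qed.

Lemma integral_0y_scale (R : realType) (f : R -> R) (l : R) : 0 < l ->
  measurable_fun setT f -> (forall x, 0 < x -> 0 <= f x) ->
  (forall x, 0 < x -> {for x, continuous f}) ->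
  (\int[lebesgue_measure]_(x in `]0%R, +oo[) (f x)%:E =
  \int[lebesgue_measure]_(x in `]0%R, +oo[) (f (l * x) * l)%:E)%E.
Proof.
move=> l0 mf f0 cf.
apply: (@integral_substitution_open R ( *%R l) (cst l) f (fun n => n.+2%:R^-1)
  (fun n => n.+2%:R)).
- exact: invn2_le_n2.
- exact: nincr_invn2.
- exact: ndecr_n2.
- exact: interval_open.
- apply: itvoy_bigcup => [n||]; [by []|exact: cvg_invn2|exact: cvg_n2].
- apply: itvoy_bigcup => [n||]; first by rewrite mulr_gt0.
    rewrite -[X in _ --> X](mulr0 l); apply: cvgMr; exact: cvg_invn2.
  apply/cvgryPge => A; near=> n; rewrite -ler_pdivrMl//; near: n.
  by have /cvgryPge := @cvg_n2 R; apply.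
- by move=> x y _ _; rewrite ltr_pM2l.
- by move=> x _; apply: is_derive_eq; rewrite scaler1.
- by move=> x _; exact: ltW.
- by move=> x _; exact: cst_continuous.
- by [].
- by apply: measurable_funM => //; apply: measurableT_comp => //.
- by move=> y /=; rewrite in_itv/= andbT; exact: f0.
- by move=> y /=; rewrite in_itv/= andbT; exact: cf.
Unshelve. all: by end_near. Qed.

(** * The Gamma function *)

(** Euler's integral with values in the extended reals: the functional equation can then be proved
    before convergence is known, and is itself used to prove convergence near 0. *)
Definition egamma (R : realType) (x : R) : \bar R :=
  (\int[lebesgue_measure]_(t in `]0%R, +oo[) (t `^ (x - 1) * expR (- t))%:E)%E.

Lemma measurable_gamma_fun (R : realType) (x : R) :
  measurable_fun setT (fun t : R => t `^ (x - 1) * expR (- t)).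
Proof.
apply: measurable_funM; first exact: measurable_powR.
by apply: measurableT_comp.
Qed.

Lemma gamma_fun_ge0 (R : realType) (x t : R) : 0 <= t `^ (x - 1) * expR (- t).
Proof. by rewrite mulr_ge0 ?powR_ge0 ?expR_ge0. Qed.

Lemma powR_continuous (R : realType) (x t : R) : 0 < t ->
  {for t, continuous (fun t : R => t `^ x)}.
Proof.
move=> t0; apply/differentiable_continuous/derivable1_diffP.
by have := is_derive1_powR x t0 => ?; exact: ex_derive.
Qed.

Lemma expRN_continuous (R : realType) : continuous (fun x : R => expR (- x)).
Proof.
move=> x; apply: continuous_comp; last exact: continuous_expR.
exact: continuousN.
Qed.

Lemma gamma_fun_continuous (R : realType) (x t : R) : 0 < t ->
  {for t, continuous (fun t : R => t `^ (x - 1) * expR (- t))}.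
Proof.
move=> t0; apply: continuousM; first exact: powR_continuous.
exact: expRN_continuous.
Qed.

Lemma egamma_ge0 (R : realType) (x : R) : (0 <= egamma x)%E.
Proof. by apply: integral_ge0 => t _; rewrite lee_fin gamma_fun_ge0. Qed.

Lemma egamma_scale (R : realType) (p l : R) : 0 < p -> 0 < l ->
  (\int[lebesgue_measure]_(t in `]0%R, +oo[) (t `^ (p - 1) * expR (- (l * t)))%:E
   = (l `^ (- p))%:E * egamma p)%E.
Proof.
move=> p0 l0; rewrite /egamma.
rewrite [in RHS](@integral_0y_scale R (fun t => t `^ (p - 1) * expR (- t)) l)//; last 3 first.
- exact: measurable_gamma_fun.
- by move=> x _; exact: gamma_fun_ge0.
- by move=> x; exact: gamma_fun_continuous.
rewrite -ge0_integralZl//.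
- apply: eq_integral => t; rewrite inE/= in_itv/= andbT => t0.
  rewrite -EFinM; congr EFin.
  rewrite powRM ?ltW// powRN -(mulr_powRB1 (ltW l0) p0).
  have L0 : l != 0 by rewrite gt_eqF.
  have P0 : l `^ (p - 1) != 0 by rewrite gt_eqF// powR_gt0.
  by field; rewrite ?L0 ?P0.
- apply/measurable_EFinP/measurable_funTS; apply: measurable_funM => //.
  apply: (measurableT_comp (measurable_gamma_fun p)).
  exact: measurable_funM.
- by move=> t _; rewrite lee_fin mulr_ge0 ?gamma_fun_ge0// ltW.
- by rewrite lee_fin powR_ge0.
Qed.

Lemma powR_expRN_cvg0 (R : realType) (x : R) :
  (n.+2%:R `^ x * expR (- n.+2%:R) : R) @[n --> \oo] --> (0 : R).
Proof.
(* With k at least x, the bound e^y >= y^(k+1) / (k+1)! leaves a spare factor 1/y; this is the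
   origin of [C]. *)
pose k := (Num.truncn `|x|).+1.
have kx : x <= k%:R by rewrite (le_trans (ler_norm _))// ltW// truncnS_gt.
pose C : R := k.+1`!%:R.
apply: (@squeeze_cvgr _ _ _ _ (cst 0) (fun n => C * n.+2%:R^-1)).
- near=> n; rewrite mulr_ge0 ?powR_ge0 ?expR_ge0//=.
  have n0 : 0 < n.+2%:R :> R by [].
  have /le_trans : n.+2%:R `^ x * expR (- n.+2%:R) <= n.+2%:R ^+ k * expR (- n.+2%:R) :> R.
    rewrite ler_wpM2r ?expR_ge0// -powR_mulrn//.
    by rewrite ler_powR// ler1n.
  apply.
  rewrite expRN ler_pdivrMr ?expR_gt0// mulrAC ler_pdivlMr//.
  have := expR_ge1Dxn k (ltW n0); rewrite -/C => h.
  rewrite -exprSr.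
  rewrite -ler_pdivrMl ?ltr0n ?fact_gt0//.
  by apply: le_trans h; rewrite mulrC lerDr.
- exact: cvg_cst.
- rewrite -[X in _ --> X](mulr0 C); apply: cvgMr; exact: cvg_invn2.
Unshelve. all: by end_near. Qed.

Lemma egammaS (R : realType) (x : R) : 0 < x ->
  egamma (x + 1) = (x%:E * egamma x)%E.
Proof.
move=> x0.
have bc : `]0, +oo[%classic = \bigcup_n `[(n.+2%:R^-1 : R), n.+2%:R]%classic.
  by apply: itvoy_bigcup => [n||]; [by []|exact: cvg_invn2|exact: cvg_n2].
have cvgG (y : R) : (\int[lebesgue_measure]_(t in `[n.+2%:R^-1%R, n.+2%:R])
    (t `^ (y - 1) * expR (- t))%:E)%E @[n --> \oo] --> egamma y.
  apply: (@cvg_integral_itvcc R _ (fun n => n.+2%:R^-1) (fun n => n.+2%:R)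
    `]0, +oo[%classic (measurable_gamma_fun y) _ _ _ bc).
  - by move=> t _; exact: gamma_fun_ge0.
  - exact: nincr_invn2.
  - exact: ndecr_n2.
apply: (cvg_unique (@ereal_hausdorff R) (cvgG _)) => /=.
(* The boundary term of the integration by parts. It vanishes at infinity by exponential decay and
   at 0 because x > 0. *)
pose bd n : R := n.+2%:R `^ x * - expR (- n.+2%:R) -
  n.+2%:R^-1 `^ x * - expR (- n.+2%:R^-1).
have cbd : bd @ \oo --> (0 : R).
  rewrite -(subr0 0) -{1}oppr0; apply: cvgB.
    by under eq_fun do rewrite mulrN; apply: cvgN; exact: powR_expRN_cvg0.
  apply: (@squeeze_cvgr _ _ _ _ (fun n => - (n.+2%:R^-1 `^ x)) (cst 0)).
  - near=> n; rewrite mulrN lerN2 oppr_le0 mulr_ge0 ?powR_ge0 ?expR_ge0// andbT.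
    by rewrite ler_piMr ?powR_ge0// expR_le1 oppr_le0.
  - rewrite -oppr0; apply: cvgN.
    have := powR_cvg0 x0 => /cvg_at_rightP/(_ (fun n => n.+2%:R^-1)); apply.
    by split => //; exact: cvg_invn2.
  - exact: cvg_cst.
have -> : (x%:E * egamma x = 0%:E + x%:E * egamma x)%E by rewrite add0e.
have : ((bd n)%:E + x%:E * \int[lebesgue_measure]_(t in `[n.+2%:R^-1%R, n.+2%:R])
    (t `^ (x - 1) * expR (- t))%:E)%E @[n --> \oo] -->
    (0%:E + x%:E * egamma x)%E.
  apply: cvgeD => //.
    by apply/fine_cvgP; split; [exact: nearW|exact: cbd].
  by apply: cvgeZl => //; exact: cvgG.
apply: cvg_trans; apply: near_eq_cvg; near=> n.
have n0 : 0 < n.+2%:R^-1 :> R by [].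
have inA t : t \in `[(n.+2%:R^-1 : R), n.+2%:R] -> 0 < t.
  by rewrite in_itv/= => /andP[/(lt_le_trans n0)].
rewrite addrK (@integration_by_parts _ (fun t => t `^ x) (fun t => - expR (- t))
  (fun t => x * t `^ (x - 1)) (fun t => expR (- t))).
- have -> : (\int[lebesgue_measure]_(t in `[n.+2%:R^-1%R, n.+2%:R])
      (x * t `^ (x - 1) * - expR (- t))%:E)%E = ((- x)%:E *
      \int[lebesgue_measure]_(t in `[n.+2%:R^-1%R, n.+2%:R])
      (t `^ (x - 1) * expR (- t))%:E)%E.
    rewrite -integralZl//.
      by apply: eq_integral => t _; rewrite -EFinM; congr EFin; ring.
    apply: continuous_compact_integrable; first exact: segment_compact.
    apply: continuous_in_subspaceT => t; rewrite inE => /inA.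
    exact: gamma_fun_continuous.
  by rewrite EFinN mulNe oppeK.
- by rewrite (@lt_trans _ _ 1)// ?invf_lt1 ?ltr1n.
- apply: continuous_in_subspaceT => t; rewrite inE => /inA t0.
  by apply: cvgMr; exact: powR_continuous.
- split.
  + move=> t; rewrite in_itv/= => /andP[t0 _].
    by have := is_derive1_powR x (lt_trans n0 t0) => ?; exact: ex_derive.
  + by apply: cvg_at_right_filter; exact: powR_continuous.
  + by apply: cvg_at_left_filter; exact: powR_continuous.
- move=> t; rewrite in_itv/= => /andP[t0 _]; rewrite derive1E.
  by have := is_derive1_powR x (lt_trans n0 t0) => ?; rewrite derive_val.
- by apply: continuous_subspaceT => t; exact: expRN_continuous.
- split.
  + by move=> t _; exact: ex_derive.
  + by apply: cvg_at_right_filter; apply: cvgN; exact: expRN_continuous.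
  + by apply: cvg_at_left_filter; apply: cvgN; exact: expRN_continuous.
- by move=> t _; rewrite derive1E derive_val; ring.
Unshelve. all: by end_near. Qed.

Lemma egamma1 (R : realType) : egamma (1 : R) = 1%E.
Proof.
rewrite /egamma subrr.
under eq_integral do rewrite powRr0 mul1r.
rewrite integral_itv_obnd_cbnd; last first.
  by apply/measurable_EFinP/measurable_funTS; exact: measurableT_comp.
rewrite (@ge0_continuous_FTC2y _ _ (fun x => - expR (- x)) _ 0).
- by rewrite oppr0 expR0 EFinN oppeK add0e.
- by move=> x _; exact: expR_ge0.
- by apply: continuous_subspaceT => t; exact: expRN_continuous.
- by rewrite -oppr0; apply: cvgN; exact: cvgr_expR.
- by move=> x _; exact: ex_derive.
- by apply: cvg_at_right_filter; apply: cvgN; exact: expRN_continuous.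
- by move=> t _; rewrite derive1E derive_val; ring.
Qed.

Lemma egammaSn (R : realType) (n : nat) : egamma (n.+1%:R : R) = n`!%:R%:E.
Proof.
elim: n => [|n IH]; first by rewrite egamma1.
by rewrite -(natr1 n.+1) egammaS// IH factS natrM EFinM.
Qed.

(** For y >= 1 the integrand lies below the sum of those at 1 (for t <= 1) and at an integer above y
    (for t >= 1). For smaller x, the functional equation would carry an infinite value at x over to
    x + 1. *)
Lemma egamma_lty (R : realType) (x : R) : 0 < x -> (egamma x < +oo)%E.
Proof.
have ge1 (y : R) : 1 <= y -> (egamma y < +oo)%E.
  move=> y1; set n := Num.truncn y.
  have yn : y <= n.+1%:R by rewrite ltW// truncnS_gt.
  apply: (@le_lt_trans _ _ (egamma 1 + egamma n.+1%:R)%E); last first.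
    by rewrite egamma1 egammaSn -EFinD ltry.
  rewrite /egamma -ge0_integralD//=; last 4 first.
  - by move=> t _; rewrite lee_fin gamma_fun_ge0.
  - by apply/measurable_EFinP/measurable_funTS; exact: measurable_gamma_fun.
  - by move=> t _; rewrite lee_fin gamma_fun_ge0.
  - by apply/measurable_EFinP/measurable_funTS; exact: measurable_gamma_fun.
  apply: ge0_le_integral => //=.
  - by move=> t _; rewrite lee_fin gamma_fun_ge0.
  - by apply/measurable_EFinP/measurable_funTS; exact: measurable_gamma_fun.
  - by apply: emeasurable_funD => //;
      apply/measurable_EFinP/measurable_funTS; exact: measurable_gamma_fun.
  - move=> t; rewrite in_itv/= andbT => t0.
    rewrite -EFinD lee_fin -mulrDl ler_wpM2r ?expR_ge0// subrr powRr0.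
    have [t1|/ltW t1] := leP t 1.
      rewrite (@le_trans _ _ 1)// ?lerDl ?powR_ge0//.
      by rewrite -[leRHS](powRr0 t) ger_powR ?t0// subr_ge0.
    by rewrite (@le_trans _ _ (t `^ (n.+1%:R - 1)))// ?lerDr// ler_powR// lerB.
move=> x0; have := ge1 (x + 1); rewrite lerDr ltW// => /(_ isT).
rewrite egammaS//; have := egamma_ge0 x; case: (egamma x) => [r _ _|//|//].
  by rewrite ltry.
by rewrite gt0_muley// lte_fin.
Qed.

Lemma EFin_Gamma (R : realType) (x : R) : 0 < x -> (Gamma x)%:E = egamma x.
Proof.
move=> x0; rewrite /Gamma /Rintegral -/(egamma x) fineK//.
by rewrite ge0_fin_numE ?egamma_lty ?egamma_ge0.
Qed.

Lemma GammaS (R : realType) (x : R) : 0 < x -> Gamma (x + 1) = x * Gamma x.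
Proof.
move=> x0; apply: EFin_inj.
by rewrite EFinM !EFin_Gamma ?addr_gt0// egammaS.
Qed.

Lemma Gamma1 (R : realType) : Gamma (1 : R) = 1.
Proof. by apply: EFin_inj; rewrite EFin_Gamma// egamma1. Qed.

Lemma Gamma_ge0 (R : realType) (x : R) : 0 < x -> 0 <= Gamma x.
Proof. by move=> x0; rewrite -lee_fin EFin_Gamma// egamma_ge0. Qed.

(** With z = e^y, factoring out e^(ay) leaves a e^((1-a)y) + (1-a) e^(-ay); bounding each
    exponential by e^u >= 1 + u makes the terms in y cancel and leaves 1. *)
Lemma powR_le_tangent (R : realType) (a z : R) : 0 < z -> 0 <= a <= 1 ->
  z `^ a <= a * z + (1 - a).
Proof.
move=> z0 /andP[a0 a1]; rewrite -[z](lnK z0); set y := ln z.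
rewrite -expRM (mulrC y).
have h1 : 1 + (1 - a) * y <= expR ((1 - a) * y) by exact: expR_ge1Dx.
have h2 : 1 + - (a * y) <= expR (- (a * y)) by exact: expR_ge1Dx.
have e1 : expR y = expR (a * y) * expR ((1 - a) * y).
  by rewrite -expRD; congr expR; ring.
have e2 : 1 = expR (a * y) * expR (- (a * y)).
  by rewrite -expRD subrr expR0.
have -> : a * expR y + (1 - a) = expR (a * y) *
    (a * expR ((1 - a) * y) + (1 - a) * expR (- (a * y))).
  by rewrite mulrDr mulrCA -e1 [X in _ = _ + X]mulrCA -e2 mulr1.
rewrite ler_peMr ?expR_ge0//.
have h3 := ler_wpM2l a0 h1; have a1' : 0 <= 1 - a by rewrite subr_ge0.
by have h4 := ler_wpM2l a1' h2; nra.
Qed.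

(* Half of log-convexity, from the tangent bound t^a <= x^a (a t / x + 1 - a). *)
Lemma Gamma_le (R : realType) (x a : R) : 0 < x -> 0 <= a <= 1 ->
  Gamma (x + a) <= x `^ a * Gamma x.
Proof.
move=> x0 a01; have /andP[a0 a1] := a01.
have xa0 : 0 < x + a by rewrite ltr_wpDr.
rewrite -lee_fin EFinM !EFin_Gamma//.
(* Since [egamma (x + 1)] is x times [egamma x], this splitting presents the bound as the integral
   of the tangent bound, so that the integrands can be compared pointwise. *)
have -> : ((x `^ a)%:E * egamma x = (x `^ a * (a / x))%:E * egamma (x + 1) +
    (x `^ a * (1 - a))%:E * egamma x)%E.
  rewrite egammaS// -!EFin_Gamma// -!EFinM -EFinD; congr EFin.
  by field; rewrite gt_eqF.
have c1 : 0 <= x `^ a * (a / x) by rewrite mulr_ge0 ?powR_ge0// divr_ge0// ltW.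
have c2 : 0 <= x `^ a * (1 - a) by rewrite mulr_ge0 ?powR_ge0 ?subr_ge0.
have Zl (c y : R) : 0 <= c -> (c%:E * egamma y = \int[lebesgue_measure]_(t in `]0%R, +oo[)
    (c%:E * (t `^ (y - 1) * expR (- t))%:E))%E.
  move=> c0; rewrite ge0_integralZl//.
  - by apply/measurable_EFinP/measurable_funTS; exact: measurable_gamma_fun.
  - by move=> t _; rewrite lee_fin gamma_fun_ge0.
rewrite !Zl// /egamma.
have mg (c y : R) : measurable_fun (`]0, +oo[%classic : set R)
    (fun t : R => c%:E * (t `^ (y - 1) * expR (- t))%:E)%E.
  apply/measurable_EFinP/measurable_funTS; apply: measurable_funM => //.
  exact: measurable_gamma_fun.
have g0 c y t : 0 <= c -> (0 <= c%:E * (t `^ (y - 1) * expR (- t))%:E)%E.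
  by move=> c0; rewrite mule_ge0// lee_fin gamma_fun_ge0.
rewrite -ge0_integralD; try by move=> *; exact: g0.
all: try exact: mg.
all: try by [].
apply: ge0_le_integral => //=.
- by move=> t _; rewrite lee_fin gamma_fun_ge0.
- by apply/measurable_EFinP/measurable_funTS; exact: measurable_gamma_fun.
- by apply: emeasurable_funD; exact: mg.
- move=> t; rewrite in_itv/= andbT => t0.
  rewrite -!EFinM -EFinD lee_fin !mulrA -mulrDl ler_wpM2r ?expR_ge0//.
  rewrite addrK.
  have -> : t `^ (x + a - 1) = t `^ (x - 1) * (x `^ a * (t / x) `^ a).
    rewrite -powRM ?divr_ge0 ?ltW// mulrCA divff ?gt_eqF// mulr1.
    rewrite -powRD; last by rewrite (gt_eqF t0) implybT.
    by congr (_ `^ _); ring.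
  have -> : t `^ x = t * t `^ (x - 1).
    by rewrite mulr_powRB1 ?ltW.
  have := powR_le_tangent (divr_gt0 t0 x0) a01.
  have p1 : 0 <= x `^ a * t `^ (x - 1) by rewrite mulr_ge0 ?powR_ge0.
  move=> /(ler_wpM2l p1) h.
  have -> : t `^ (x - 1) * (x `^ a * (t / x) `^ a) =
    x `^ a * t `^ (x - 1) * (t / x) `^ a by ring.
  by apply: (le_trans h); rewrite le_eqVlt; apply/orP; left; apply/eqP; ring.
Qed.

(** By [Gamma_le], a zero at x would force the value at the next integer n + 1, which is n!, to be
    at most 0. *)
Lemma Gamma_gt0 (R : realType) (x : R) : 0 < x -> 0 < Gamma x.
Proof.
move=> x0; rewrite lt_neqAle Gamma_ge0// andbT eq_sym; apply/eqP => Gx0.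
set n := Num.truncn x.
have /andP[nx xn] := truncn_itv (ltW x0).
have /(Gamma_le x0) : 0 <= n.+1%:R - x <= 1 by rewrite -natr1; lra.
rewrite Gx0 mulr0 addrCA subrr addr0 -lee_fin EFin_Gamma// egammaSn lee_fin.
by rewrite leNgt ltr0n fact_gt0.
Qed.

Lemma Gamma_half (R : realType) : Gamma (1 / 2 : R) = Num.sqrt pi.
Proof.
apply: EFin_inj; rewrite EFin_Gamma ?divr_gt0// /egamma.
(* The substitution t = x^2 yields twice the Gaussian integral over the half-line. *)
transitivity (\int[@lebesgue_measure R]_(x in `]0%R, +oo[)
    ((x ^+ 2) `^ (1 / 2 - 1) * expR (- x ^+ 2) * (2 * x))%:E)%E; last first.
  transitivity (\int[@lebesgue_measure R]_(x in `]0%R, +oo[) (2 * gauss_fun x)%:E)%E.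
    apply: eq_integral => x; rewrite inE/= in_itv/= andbT => x0; congr EFin.
    rewrite -powR_mulrn ?ltW// -powRrM.
    have -> : 2%:R * (1 / 2 - 1) = (- 1 : R) by field.
    rewrite powR_inv1 ?ltW// powR_mulrn ?ltW// /gauss_fun.
    by field; rewrite gt_eqF.
  under eq_integral do rewrite EFinM.
  rewrite ge0_integralZl//; last 2 first.
  + by apply/measurable_EFinP/measurable_funTS; exact: measurable_gauss_fun.
  + by move=> x _; rewrite lee_fin gauss_fun_ge0.
  rewrite integral_itv_obnd_cbnd; last first.
    by apply/measurable_EFinP/measurable_funTS; exact: measurable_gauss_fun.
  by rewrite integral0y_gauss -EFinM mulrCA divff// mulr1.
apply: (@integral_substitution_open R (fun x => x ^+ 2) (fun x => 2 * x)
  (fun t => t `^ (1 / 2 - 1) * expR (- t)) (fun n => n.+2%:R^-1)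
  (fun n => n.+2%:R) `]0, +oo[%classic `]0, +oo[%classic).
- exact: invn2_le_n2.
- exact: nincr_invn2.
- exact: ndecr_n2.
- exact: interval_open.
- by apply: itvoy_bigcup => [n||]; [by []|exact: cvg_invn2|exact: cvg_n2].
- apply: itvoy_bigcup => [n||]; first by rewrite exprn_gt0.
    rewrite -[X in _ --> X](mulr0 0).
    under eq_fun do rewrite expr2.
    by apply: cvgM; exact: cvg_invn2.
  apply/cvgryPge => A; near=> n.
  rewrite (@le_trans _ _ n.+2%:R)//; last first.
    by rewrite expr2 ler_peMr// ler1n.
  by near: n; have /cvgryPge := @cvg_n2 R; apply.
- move=> x y /[!inE]/=; rewrite !in_itv/= !andbT => x0 y0 xy.
  by rewrite ltr_pXn2r// nnegrE ltW.
- by move=> x _; apply: is_derive_eq; rewrite /= ?scaler1 ?expr1 mulr_natl.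
- by move=> x /=; rewrite in_itv/= andbT => x0; rewrite mulr_ge0// ltW.
- by move=> x _; apply: continuousM => //; exact: cst_continuous.
- exact: measurable_gamma_fun.
- apply: measurable_funM; last exact: measurable_funM.
  apply: (measurableT_comp (measurable_gamma_fun (1 / 2))).
  exact: measurable_funX.
- by move=> t _; exact: gamma_fun_ge0.
- by move=> t /=; rewrite in_itv/= andbT => /gamma_fun_continuous; apply.
Unshelve. all: by end_near. Qed.

Lemma ler_harmonic (R : realType) (x y C : R) :
  (forall n, x <= y + C / n.+1%:R) -> x <= y.
Proof.
move=> h; apply: (@ler_cvg_to _ (\oo : set_system nat) _ R (cst x)
  (fun n => y + C * n.+1%:R^-1)).
- exact: cvg_cst.
- rewrite -[X in _ --> X]addr0; apply: cvgD; first exact: cvg_cst.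
  by rewrite -(mulr0 C); apply: cvgMr; exact: cvg_harmonic.
- exact: nearW.
Qed.

(** * The half-step ratio of Gamma and the series for its logarithm *)

Definition gratio (R : realType) (s : R) : R := Gamma (s + 1 / 2) / Gamma (s + 1).

(** The choice of s + 1/2 makes the step factor (s+1/2)(s+3/2) / (s+1)^2 equal to 1 minus a multiple
    of (s+1)^(-2), and this deficit is a Laplace transform. *)
Definition gratioq (R : realType) (s : R) : R := gratio s ^+ 2 * (s + 1 / 2).

Lemma gratio_gt0 (R : realType) (s : R) : 0 <= s -> 0 < gratio s.
Proof. by move=> s0; rewrite divr_gt0// Gamma_gt0//; lra. Qed.

Lemma gratioS (R : realType) (s : R) : 0 <= s ->
  gratio (s + 1) = gratio s * ((s + 1 / 2) / (s + 1)).
Proof.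
move=> s0; rewrite /gratio GammaS; last lra.
have -> : s + 1 + 1 / 2 = s + 1 / 2 + 1 by ring.
rewrite GammaS; last lra.
have G0 : Gamma (s + 1) != 0 by rewrite gt_eqF// Gamma_gt0//; lra.
have S0 : s + 1 != 0 by rewrite gt_eqF//; lra.
by field; rewrite ?G0 ?S0.
Qed.

(** The algebra behind [gratioq_itv]: g and h stand for Gamma at s + 1 and s + 1/2, p and q for the
    square roots produced by [Gamma_le] with exponent 1/2. *)
Lemma sqr_ratio_itv (R : realType) (g h s p q : R) :
  0 <= s -> 0 < g -> 0 < h -> 0 <= p -> 0 <= q ->
  p ^+ 2 = s + 1 / 2 -> q ^+ 2 = s + 1 ->
  g <= p * h -> (s + 1 / 2) * h <= q * g ->
  1 <= (h / g) ^+ 2 * (s + 1 / 2) <= 1 + (2 * s + 1)^-1.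
Proof.
move=> s0 g0 h0 p0 q0 pE qE h1 h2.
have s1 : 0 < s + 1 / 2 by lra.
have {}h1 : g ^+ 2 <= (s + 1 / 2) * h ^+ 2.
  by rewrite -pE -exprMn ler_pXn2r ?nnegrE ?mulr_ge0 ?(ltW g0) ?(ltW h0).
have {}h2 : (s + 1 / 2) ^+ 2 * h ^+ 2 <= (s + 1) * g ^+ 2.
  by rewrite -qE -!exprMn ler_pXn2r ?nnegrE ?mulr_ge0 ?(ltW g0) ?(ltW h0) ?(ltW s1).
have g20 : 0 < g ^+ 2 by rewrite exprn_gt0.
have -> : (h / g) ^+ 2 * (s + 1 / 2) = (s + 1 / 2) * h ^+ 2 / g ^+ 2.
  by field; rewrite gt_eqF.
apply/andP; split; first by rewrite ler_pdivlMr// (mul1r (g ^+ 2)).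
rewrite ler_pdivrMr//.
have -> : 1 + (2 * s + 1)^-1 = (s + 1) / (s + 1 / 2).
  rewrite (_ : s + 1 / 2 = (2 * s + 1) / 2); last by field.
  by field; rewrite gt_eqF//; lra.
rewrite mulrAC ler_pdivlMr//; apply: le_trans h2.
by rewrite le_eqVlt; apply/orP; left; apply/eqP; ring.
Qed.

(** The lower bound comes from the half-step from s + 1/2 to s + 1, the upper bound from the next
    one, from s + 1 to s + 3/2. *)
Lemma gratioq_itv (R : realType) (s : R) : 0 <= s ->
  1 <= gratioq s <= 1 + (2 * s + 1)^-1.
Proof.
move=> s0.
have a01 : 0 <= (2^-1 : R) <= 1 by lra.
have p1 : 0 < s + 1 / 2 by lra.
have p2 : 0 < s + 1 by lra.
have := Gamma_le p1 a01; have := Gamma_le p2 a01.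
rewrite (powR12_sqrt (ltW p1)) (powR12_sqrt (ltW p2)).
have -> : s + 1 + 2^-1 = s + 1 / 2 + 1 by field.
have -> : s + 1 / 2 + 2^-1 = s + 1 by field.
rewrite GammaS// => h1 h2.
apply: (sqr_ratio_itv s0 (Gamma_gt0 p2) (Gamma_gt0 p1) (sqrtr_ge0 _)
  (sqrtr_ge0 _) _ _ h2 h1); apply: sqr_sqrtr; exact: ltW.
Qed.

Lemma gratioqS (R : realType) (s : R) : 0 <= s ->
  gratioq (s + 1) = gratioq s * (1 - (4 * (s + 1) ^+ 2)^-1).
Proof.
move=> s0; rewrite /gratioq gratioS//.
by field; rewrite gt_eqF//; lra.
Qed.

Lemma gratioq_gt0 (R : realType) (s : R) : 0 <= s -> 0 < gratioq s.
Proof.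
by move=> s0; have /andP[+ _] := gratioq_itv s0; apply: lt_le_trans.
Qed.

Lemma ln_gratioq_cvg0 (R : realType) (s : R) : 0 <= s ->
  ln (gratioq (s + n%:R)) @[n --> \oo] --> (0 : R).
Proof.
move=> s0; apply: (@squeeze_cvgr _ _ _ _ (cst 0) (fun n => n.+1%:R^-1)).
- near=> n.
  have sn0 : 0 <= s + n%:R by rewrite addr_ge0.
  have /andP[q1 q2] := gratioq_itv sn0.
  rewrite ln_ge0//=.
  rewrite -[X in ln X](subrK 1) addrC (le_trans (le_ln1Dx _))//; first lra.
  rewrite lerBlDl (le_trans q2)// lerD2l lef_pV2 ?posrE//; last first.
    by rewrite ltr_wpDl// mulr_ge0.
  rewrite -[n.+1%:R]natr1 lerD2r.
  rewrite (@le_trans _ _ (s + n%:R))// ?lerDr//.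
  by rewrite ler_peMl// ler1n.
- exact: cvg_cst.
- exact: cvg_harmonic.
Unshelve. all: by end_near. Qed.

Lemma cvg_series_ln_gratioq (R : realType) (s : R) : 0 <= s ->
  series (fun k => - ln (1 - (4 * (s + k.+1%:R) ^+ 2)^-1)) @ \oo -->
  ln (gratioq s).
Proof.
move=> s0.
(* By [gratioqS] the series telescopes. *)
have -> : series (fun k => - ln (1 - (4 * (s + k.+1%:R) ^+ 2)^-1)) =
    fun n => ln (gratioq s) - ln (gratioq (s + n%:R)).
  apply/funext; elim => [|n IH].
    by rewrite seriesEnat/= big_nil addr0 subrr.
  rewrite seriesSr IH.
  have sn0 : 0 <= s + n%:R by rewrite addr_ge0.
  have q0 := gratioq_gt0 sn0.
  have sn1 : 0 <= s + n%:R + 1 by rewrite addr_ge0.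
  have q1 := gratioq_gt0 sn1.
  rewrite -[n.+1%:R]natr1 addrA gratioqS// lnM ?posrE//; last first.
    by move: q1; rewrite gratioqS// pmulr_rgt0.
  by rewrite opprD addrA.
rewrite -[X in _ --> X]subr0; apply: cvgB; first exact: cvg_cst.
exact: ln_gratioq_cvg0.
Qed.

(** The lower bound is [Gamma_le] for the complementary step 1 - a from x + a to x + 1, after
    replacing x^a (x+a)^(1-a) by the larger x + 1. *)
Lemma Gamma_ratio_itv (R : realType) (x a : R) : 0 < x -> 0 <= a <= 1 ->
  x / (x + 1) * (x `^ a * Gamma x) <= Gamma (x + a) <= x `^ a * Gamma x.
Proof.
move=> x0 a01; rewrite Gamma_le// andbT; have /andP[a0 a1] := a01.
have xa0 : 0 < x + a by lra.
have b01 : 0 <= 1 - a <= 1 by lra.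
have := Gamma_le xa0 b01.
have -> : x + a + (1 - a) = x + 1 by ring.
rewrite GammaS// -ler_pdivrMl ?powR_gt0//; apply: le_trans.
have x10 : x + 1 != 0 by rewrite gt_eqF//; lra.
have -> : x / (x + 1) * (x `^ a * Gamma x) = x * Gamma x * (x `^ a / (x + 1)).
  by field.
rewrite [leRHS]mulrC; apply: ler_wpM2l; first by rewrite mulr_ge0 ?Gamma_ge0 ?(ltW x0).
rewrite ler_pdivrMr; last lra.
rewrite ler_pdivlMl ?powR_gt0// mulrC.
have -> : x + 1 = (x + 1) `^ a * (x + 1) `^ (1 - a).
  rewrite -powRD; last by rewrite gt_eqF ?implybT//; lra.
  by rewrite addrCA subrr addr0 powRr1//; lra.
apply: ler_pM; rewrite ?powR_ge0//; apply: ge0_ler_powR;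
  by rewrite ?nnegrE//; lra.
Qed.

(** * The duplication formula *)

(* The duplication formula says [gdup s = 1]; [gdup] is 1/2-periodic and equals 1 at 0,
   and [Gamma_ratio_itv] forces it to be asymptotically constant. *)
Definition gdup (R : realType) (s : R) : R :=
  Gamma (2 * s + 1) * Num.sqrt pi / (4 `^ s * Gamma (s + 1 / 2) * Gamma (s + 1)).

(** A half-step advances Gamma(2s+1) by one unit and sends the lower Gammas to each other's place,
    one of them a unit further; the extra factors 2s + 1, s + 1/2 and 4^(1/2) cancel. *)
Lemma gdup_half (R : realType) (s : R) : 0 <= s -> gdup (s + 1 / 2) = gdup s.
Proof.
move=> s0; rewrite /gdup.
have -> : 2 * (s + 1 / 2) + 1 = 2 * s + 1 + 1 by field.
have -> : s + 1 / 2 + 1 / 2 = s + 1 by field.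
rewrite (@GammaS _ (2 * s + 1)); last lra.
rewrite (@GammaS _ (s + 1 / 2)); last lra.
have G0 : Gamma (s + 1 / 2) != 0 by rewrite gt_eqF// Gamma_gt0//; lra.
have G1 : Gamma (s + 1) != 0 by rewrite gt_eqF// Gamma_gt0//; lra.
have P0 : 4 `^ s != 0 :> R by rewrite gt_eqF// powR_gt0.
have -> : 4 `^ (s + 1 / 2) = 4 `^ s * 2 :> R.
  rewrite powRD; last by rewrite pnatr_eq0 implybT.
  rewrite mul1r powR12_sqrt//; congr (_ * _).
  have -> : 4 = 2 ^+ 2 :> R by ring.
  by rewrite sqrtr_sqr ger0_norm.
have S1 : 2 * s + 1 != 0 by rewrite gt_eqF//; lra.
move: (Gamma _) (Gamma _) (Gamma _) (Num.sqrt pi) (4 `^ s) G0 G1 P0.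
move=> g2 g1 g0 c1 c2 G0 G1 P0.
have -> : s + 1 / 2 = (2 * s + 1) / 2 by field.
move: (2 * s + 1) S1 => k k0.
by field; rewrite ?(G0, G1, P0, k0).
Qed.

Lemma gdup_halfn (R : realType) (s : R) n : 0 <= s ->
  gdup (s + n%:R / 2) = gdup s.
Proof.
move=> s0; elim: n => [|n IH]; first by rewrite mul0r addr0.
rewrite -IH -[RHS]gdup_half; last by rewrite addr_ge0// divr_ge0.
by congr gdup; rewrite -[n.+1%:R]natr1; field.
Qed.

Lemma gdup0 (R : realType) : gdup (0 : R) = 1.
Proof.
rewrite /gdup mulr0 !add0r Gamma1 Gamma_half powRr0 !mul1r mulr1 divff//.
by rewrite gt_eqF// sqrtr_gt0 pi_gt0.
Qed.

(** The arithmetic of [gdup_shift_itv]: the g's are Gamma at x, y, z, the f's Gamma at the shifted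
    points, p, q, r the powers approximating f/g, and the [a] of this lemma is a power of 4. *)
Lemma ratio3_itv (R : realType) (x y z f1 f2 f3 g1 g2 g3 p q r a D : R) :
  0 < x -> 0 < y -> 0 < z -> 0 < g1 -> 0 < g2 -> 0 < g3 ->
  0 < f1 -> 0 < f2 -> 0 < f3 -> 0 < p -> 0 < q -> 0 < r ->
  y / z <= q / r <= 1 ->
  p = a * q * q -> 0 < a ->
  x / (x + 1) * (p * g1) <= f1 <= p * g1 ->
  y / (y + 1) * (q * g2) <= f2 <= q * g2 ->
  z / (z + 1) * (r * g3) <= f3 <= r * g3 ->
  D = f1 * g2 * g3 / (g1 * (a * f2 * f3)) ->
  x / (x + 1) * (y / z) <= D <= (y + 1) / y * ((z + 1) / z).
Proof.
move=> x0 y0 z0 g10 g20 g30 f10 f20 f30 p0 q0 r0 /andP[ql qu] pE a0.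
move=> /andP[l1 u1] /andP[l2 u2] /andP[l3 u3] DE.
(* The relative errors of the three approximations. [D] is their product times q / r, which is left
   over because p equals a q^2 and not a q r. *)
pose e1 := f1 / (p * g1); pose e2 := q * g2 / f2; pose e3 := r * g3 / f3.
have pg : 0 < p * g1 by rewrite mulr_gt0.
have e1l : x / (x + 1) <= e1 by rewrite ler_pdivlMr.
have e1u : e1 <= 1 by rewrite ler_pdivrMr// mul1r.
have e2l : 1 <= e2 by rewrite ler_pdivlMr// mul1r.
have e3l : 1 <= e3 by rewrite ler_pdivlMr// mul1r.
have y1 : 0 < y + 1 by rewrite addr_gt0.
have z1 : 0 < z + 1 by rewrite addr_gt0.
have x1 : 0 < x + 1 by rewrite addr_gt0.
have e2u : e2 <= (y + 1) / y.
  rewrite ler_pdivrMr// -ler_pdivrMl ?divr_gt0// invf_div.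
  exact: l2.
have e3u : e3 <= (z + 1) / z.
  rewrite ler_pdivrMr// -ler_pdivrMl ?divr_gt0// invf_div.
  exact: l3.
have -> : D = e1 * (q / r) * (e2 * e3).
  rewrite DE /e1 /e2 /e3 pE.
  have [h1 h2 h3] : [/\ g1 != 0, g2 != 0 & g3 != 0] by rewrite !gt_eqF.
  have [k1 k2] : f2 != 0 /\ f3 != 0 by rewrite !gt_eqF.
  have [j1 j2 j3] : [/\ a != 0, q != 0 & r != 0] by rewrite !gt_eqF.
  by field; rewrite ?(h1, h2, h3, k1, k2, j1, j2, j3).
have E1 : 0 <= x / (x + 1) by rewrite divr_ge0// ltW.
have E2 : 0 <= y / z by rewrite divr_ge0// ltW.
have E3 : 0 <= e1 by apply: le_trans e1l.
have E4 : 0 <= q / r by apply: le_trans ql.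
have E5 : 0 <= e2 by apply: le_trans e2l.
have E6 : 0 <= e3 by apply: le_trans e3l.
have m23 : 1 <= e2 * e3 by rewrite -[leLHS]mulr1 ler_pM.
apply/andP; split.
  apply: (@le_trans _ _ (e1 * (q / r))); first exact: ler_pM.
  by rewrite ler_peMr// mulr_ge0.
apply: (@le_trans _ _ (e2 * e3)); last exact: ler_pM.
apply: ler_piMl; first exact: mulr_ge0.
by rewrite -[leRHS]mulr1; exact: ler_pM.
Qed.

(** Written as [gdup (m + a) / gdup m], the value [gdup a] involves only ratios of Gamma over the
    shifts 2a, a and a; a <= 1/2 keeps the first within the range of [Gamma_ratio_itv]. *)
Lemma gdup_shift_itv (R : realType) (m a : R) : 0 <= m -> 0 <= a -> a <= 1 / 2 ->
  gdup (m + a) = gdup a -> gdup m = 1 ->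
  (m * 2 + 1) / (m * 2 + 1 + 1) * ((m + 1 / 2) / (m + 1)) <= gdup a <=
  (m + 1 / 2 + 1) / (m + 1 / 2) * ((m + 1 + 1) / (m + 1)).
Proof.
move=> m0 a0 a1.
have x0 : 0 < m * 2 + 1 by lra.
have y0 : 0 < m + 1 / 2 by lra.
have z0 : 0 < m + 1 by lra.
have b01 : 0 <= 2 * a <= 1 by lra.
have a01 : 0 <= a <= 1 by lra.
have f1 : 0 < m * 2 + 1 + 2 * a by lra.
have f2 : 0 < m + 1 / 2 + a by lra.
have f3 : 0 < m + 1 + a by lra.
have b4 : 0 < 4 `^ a :> R by rewrite powR_gt0.
have yz : 0 < (m + 1 / 2) / (m + 1) <= 1.
  by rewrite divr_gt0//= ler_pdivrMr//; lra.
move=> Dn D0.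
apply: (ratio3_itv x0 y0 z0 (Gamma_gt0 x0) (Gamma_gt0 y0) (Gamma_gt0 z0)
  (Gamma_gt0 f1) (Gamma_gt0 f2) (Gamma_gt0 f3) (powR_gt0 _ x0) (powR_gt0 _ y0)
  (powR_gt0 _ z0) _ _ b4 (Gamma_ratio_itv x0 b01) (Gamma_ratio_itv y0 a01)
  (Gamma_ratio_itv z0 a01)).
- clear Dn D0.
  have -> : (m + 1 / 2) `^ a / (m + 1) `^ a = ((m + 1 / 2) / (m + 1)) `^ a.
    rewrite powRM ?invr_ge0 ?(ltW y0) ?(ltW z0)//.
    by rewrite -(powR_inv1 (ltW z0)) -powRrM mulN1r powRN.
  rewrite ger1_powR//=; last by lra.
  by rewrite -[leRHS](powRr0 ((m + 1 / 2) / (m + 1))) ger_powR.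
(* (2m+1)^(2a) = 4^a (m+1/2)^(2a): this is how the power of 4 in [gdup] gets absorbed. *)
- clear Dn D0; rewrite powRrM powR_mulrn ?(ltW x0)// -!powRM ?mulr_ge0 ?(ltW y0)//.
  by congr (_ `^ _); field.
- have -> : gdup a = gdup (m + a) / gdup m by rewrite D0 divr1 Dn.
  rewrite /gdup.
  have -> : 2 * (m + a) + 1 = m * 2 + 1 + 2 * a by ring.
  have -> : m + a + 1 / 2 = m + 1 / 2 + a by ring.
  have -> : m + a + 1 = m + 1 + a by ring.
  have -> : 2 * m + 1 = m * 2 + 1 by ring.
  have -> : 4 `^ (m + a) = 4 `^ m * 4 `^ a :> R.
    by rewrite powRD// pnatr_eq0 implybT.
  have P1 : Num.sqrt pi != 0 :> R by rewrite gt_eqF// sqrtr_gt0 pi_gt0.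
  have P2 : 4 `^ m != 0 :> R by rewrite gt_eqF// powR_gt0.
  have P3 := lt0r_neq0 b4.
  have [k1 k2 k3] := And3 (lt0r_neq0 (Gamma_gt0 x0)) (lt0r_neq0 (Gamma_gt0 y0))
    (lt0r_neq0 (Gamma_gt0 z0)).
  have [k4 k5] := conj (lt0r_neq0 (Gamma_gt0 f2)) (lt0r_neq0 (Gamma_gt0 f3)).
  move: (Num.sqrt pi) (4 `^ m) (4 `^ a) (Gamma _) (Gamma _) (Gamma _)
    (Gamma _) (Gamma _) (Gamma _) P1 P2 P3 k1 k2 k3 k4 k5.
  move=> {Dn D0} c1 c2 c3 c4 c5 c6 c7 c8 c9 P1 P2 P3 k1 k2 k3 k4 k5.
  by field; rewrite ?(P1, P2, P3, k1, k2, k3, k4, k5).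
Qed.

Lemma gdup_shift (R : realType) (a : R) n : 0 <= a -> a <= 1 / 2 ->
  (n%:R * 2 + 1) / (n%:R * 2 + 1 + 1) * ((n%:R + 1 / 2) / (n%:R + 1)) <= gdup a <=
  (n%:R + 1 / 2 + 1) / (n%:R + 1 / 2) * ((n%:R + 1 + 1) / (n%:R + 1)).
Proof.
have nE : n.*2%:R / 2 = n%:R :> R by rewrite -muln2 natrM mulfK.
move=> a0 a1; apply: (gdup_shift_itv (ler0n R n) a0 a1).
  by rewrite -{1}nE addrC; exact: gdup_halfn.
by rewrite -[X in gdup X]add0r -nE -[RHS](gdup0 R); exact: gdup_halfn.
Qed.

Lemma gdup1 (R : realType) (s : R) : 0 <= s -> gdup s = 1.
Proof.
move=> s0.
have := truncn_itv (mulr_ge0 (ler0n R 2) s0).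
set m := Num.truncn _ => /andP[m1 m2].
pose a := s - m%:R / 2.
have a0 : 0 <= a by rewrite /a; lra.
have a1 : a <= 1 / 2 by move: m2; rewrite -[m.+1%:R]natr1 /a; lra.
have -> : s = a + m%:R / 2 by rewrite /a subrK.
rewrite gdup_halfn//; apply/eqP; rewrite eq_le; apply/andP; split.
(* The constant 5 makes the comparison below an equality at n = 0. *)
- apply: (@ler_harmonic _ _ _ 5) => n.
  have /andP[_ /le_trans] := gdup_shift n a0 a1; apply.
  rewrite -[n.+1%:R]natr1; move: (n%:R : R) (ler0n R n) => k k0.
  have y0 : 0 < k + 1 / 2 by lra.
  have z0 : 0 < k + 1 by lra.
  rewrite mulf_div ler_pdivrMr ?mulr_gt0//.
  have -> : (1 + 5 / (k + 1)) * ((k + 1 / 2) * (k + 1)) = (k + 6) * (k + 1 / 2).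
    by field; rewrite gt_eqF.
  by nra.
- apply: (@ler_harmonic _ _ _ 1) => n.
  have /andP[h _] := gdup_shift n a0 a1.
  rewrite -lerBlDr; apply: (le_trans _ h) => {h}.
  rewrite -[n.+1%:R]natr1; move: (n%:R : R) (ler0n R n) => k k0.
  have z0 : 0 < k + 1 by lra.
  have x0 : 0 < k * 2 + 1 + 1 by lra.
  rewrite mulf_div ler_pdivlMr ?mulr_gt0//.
  have -> : (1 - 1 / (k + 1)) * ((k * 2 + 1 + 1) * (k + 1)) = k * (k * 2 + 2).
    by field; rewrite gt_eqF.
  by nra.
Qed.

Lemma Gamma_duplication (R : realType) (s : R) : 0 <= s ->
  2 `^ s / Num.sqrt pi * (Gamma (s + 1 / 2) / Gamma (s + 1)) =
  1 / 2 `^ s * (Gamma (2 * s + 1) / Gamma (s + 1) ^+ 2).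
Proof.
move=> s0; have := gdup1 s0; rewrite /gdup.
have G0 : Gamma (s + 1 / 2) != 0 by rewrite gt_eqF// Gamma_gt0//; lra.
have G1 : Gamma (s + 1) != 0 by rewrite gt_eqF// Gamma_gt0//; lra.
have P0 : 2 `^ s != 0 :> R by rewrite gt_eqF// powR_gt0.
have P1 : Num.sqrt pi != 0 :> R by rewrite gt_eqF// sqrtr_gt0 pi_gt0.
have -> : 4 `^ s = 2 `^ s * 2 `^ s :> R.
  by rewrite -powRM//; congr (_ `^ _); ring.
set K := 2 `^ s * 2 `^ s * Gamma (s + 1 / 2) * Gamma (s + 1).
have K0 : K != 0 by rewrite !mulf_neq0.
move=> /(congr1 ( *%R^~ K)); rewrite divfK// (mul1r K) /K => {K K0}.
move: (Num.sqrt pi) (2 `^ s) (Gamma _) (Gamma _) (Gamma _) P0 P1 G0 G1.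
move=> c1 c2 g2 g0 g1 P0 P1 G0 G1 h.
have -> : g2 = c2 * c2 * g1 * g0 / c1 by rewrite -h mulfK.
by field; rewrite ?(P0, P1, G0, G1).
Qed.

(** * The central binomial sequence as values of the Gamma ratio *)

Lemma BbarS (R : realType) n :
  Bbar R n.+1 = Bbar R n * ((n%:R * 2 + 1) / (n%:R + 1)).
Proof.
have binE m : 'C(2 * m, m)%:R = (2 * m)`!%:R / m`!%:R ^+ 2 :> R.
  have /(congr1 (fun k => k%:R : R)) := @bin_fact (2 * m) m (leq_pmull _ (isT : 0 < 2)%N).
  rewrite mul2n -addnn addnK !natrM => <-.
  by rewrite -expr2 mulfK// expf_neq0// pnatr_eq0 -lt0n fact_gt0.
have F0 m : m`!%:R != 0 :> R by rewrite pnatr_eq0 -lt0n fact_gt0.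
have N0 : n%:R + 1 != 0 :> R by rewrite gt_eqF// ltr_wpDl.
rewrite /Bbar !binE mulnS addnC addn2 !factS !natrM exprS -[(2 * n).+1%:R]natr1
  -[(2 * n).+2%:R]natr1 -[(2 * n).+1%:R]natr1 -[n.+1%:R]natr1 natrM.
have T0 : 2 ^+ n != 0 :> R by rewrite expf_neq0.
by field; rewrite F0 N0 T0.
Qed.

(** Both sides start at 1 and are multiplied by (2n+1)/(n+1) at each step, so the Mellin transform
    at integers gives the moments. *)
Lemma gratio_nat (R : realType) n :
  2 `^ n%:R / Num.sqrt pi * (Gamma (n%:R + 1 / 2) / Gamma (n%:R + 1)) = Bbar R n.
Proof.
have P1 : Num.sqrt pi != 0 :> R by rewrite gt_eqF// sqrtr_gt0 pi_gt0.
elim: n => [|n IH].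
  by rewrite !add0r Gamma_half Gamma1 powRr0 Bbar0 divr1 divfK.
rewrite BbarS -IH -[n.+1%:R]natr1 -/(gratio _) gratioS// -/(gratio n%:R).
move: (gratio _) => g.
have -> : 2 `^ (n%:R + 1) = 2 `^ n%:R * 2 :> R.
  by rewrite powRD ?pnatr_eq0 ?implybT// powRr1.
have N0 : n%:R + 1 != 0 :> R by rewrite gt_eqF// ltr_wpDl.
by field; rewrite P1 N0.
Qed.

Lemma Bbar_gt0 (R : realType) n : 0 < Bbar R n.
Proof.
rewrite /Bbar mulr_gt0 ?invr_gt0 ?exprn_gt0// ltr0n bin_gt0.
by rewrite leq_pmull.
Qed.

(** The step ratio (2n+1)/(n+1) stays below 2. This geometric bound is what makes the moment
    problems determinate. *)
Lemma Bbar_le (R : realType) n : Bbar R n <= 2 ^+ n.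
Proof.
elim: n => [|n IH]; first by rewrite Bbar0 expr0.
rewrite BbarS exprSr; apply: ler_pM => //; first exact/ltW/Bbar_gt0.
by rewrite ler_pdivrMr ?ltr_wpDl//; have := ler0n R n; lra.
Qed.

(** * Measures with a density *)

Section density.
Import HBNNSimple.
Local Open Scope ereal_scope.

Lemma nnsfun_integral_density d (T : measurableType d) (R : realType)
    (mu nu : {measure set T -> \bar R}) (f : T -> R) (g : {nnsfun T >-> R}) :
  measurable_fun setT f -> (forall x, 0 <= f x)%R ->
  (forall A, measurable A -> nu A = \int[mu]_(x in A) (f x)%:E) ->
  \int[nu]_x (g x)%:E = \int[mu]_x ((g x)%:E * (f x)%:E).
Proof.
move=> mf f0 nuE.
have gE x : (g x)%:E = \sum_(y \in range g) (y * \1_(g @^-1` [set y]) x)%:E.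
  by rewrite fsumEFin// -fimfunE.
have y1ge0 y x : (0 <= (y * \1_(g @^-1` [set y]) x)%:E).
  exact: nnfun_muleindic_ge0.
under eq_integral do rewrite gE.
rewrite ge0_integral_fsum//; last first.
  by move=> y; apply/measurable_EFinP; exact: measurable_funM.
under [RHS]eq_integral => x _.
  rewrite gE ge0_mule_fsuml//; over.
rewrite ge0_integral_fsum//; last 2 first.
- move=> y; apply: emeasurable_funM; apply/measurable_EFinP => //.
  exact: measurable_funM.
- by move=> y x _; rewrite mule_ge0// lee_fin.
apply: eq_fsbigr => y; rewrite inE => -[z _ gz].
have y0 : (0 <= y)%R by rewrite -gz.
have mgy : measurable (g @^-1` [set y]) by [].
under eq_integral do rewrite EFinM.
rewrite ge0_integralZl//; last first.
  exact/measurable_EFinP.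
rewrite integral_indic// setIT nuE//.
under [RHS]eq_integral do rewrite EFinM -muleA.
rewrite ge0_integralZl//; last 2 first.
- apply: emeasurable_funM; apply/measurable_EFinP => //.
- by move=> x _; rewrite mule_ge0// lee_fin.
congr (_ * _); rewrite integral_mkcond; apply: eq_integral => x _.
by rewrite epatch_indic muleC.
Qed.

(** The density is given by its values on sets only, so that the result covers both the measure of
    [density_measure] and the law of a random variable. *)
Lemma ge0_integral_density d (T : measurableType d) (R : realType)
    (mu nu : {measure set T -> \bar R}) (f : T -> R) :
  measurable_fun setT f -> (forall x, 0 <= f x)%R ->
  (forall A, measurable A -> nu A = \int[mu]_(x in A) (f x)%:E) ->
  forall h : T -> \bar R, measurable_fun setT h -> (forall x, 0 <= h x) ->
  \int[nu]_x h x = \int[mu]_x (h x * (f x)%:E).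
Proof.
move=> mf f0 nuE h mh h0.
pose g := nnsfun_approx measurableT mh.
have cg x : (g n x)%:E @[n --> \oo] --> h x by exact: cvg_nnsfun_approx.
have ndg x : {homo (fun n => (g n x)%:E) : m n / (m <= n)%N >-> m <= n}.
  by move=> m n mn; rewrite lee_fin; exact/lefP/nd_nnsfun_approx.
transitivity (\int[nu]_x limn (fun n => (g n x)%:E)).
  by apply: eq_integral => x _; apply/esym/cvg_lim.
rewrite monotone_convergence//; last 2 first.
- by move=> n; exact/measurable_EFinP.
- by move=> n x _; rewrite lee_fin.
transitivity (\int[mu]_x limn (fun n => (g n x)%:E * (f x)%:E)); last first.
  apply: eq_integral => x _; apply/cvg_lim => //.
  by apply: cvgeZr => //; exact: cg.
rewrite monotone_convergence//; last 3 first.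
- by move=> n; apply: emeasurable_funM; exact/measurable_EFinP.
- by move=> n x _; rewrite mule_ge0// lee_fin.
- by move=> x _ m n mn; apply: lee_wpmul2r; rewrite ?lee_fin//; exact: ndg.
by congr (limn _); apply/funext => n; exact: nnsfun_integral_density.
Qed.

Lemma density_measure d (T : measurableType d) (R : realType)
    (mu : {measure set T -> \bar R}) (f : T -> R) :
  measurable_fun setT f -> (forall x, 0 <= f x)%R ->
  exists nu : {measure set T -> \bar R},
    forall A, measurable A -> nu A = \int[mu]_(x in A) (f x)%:E.
Proof.
move=> mf f0; pose m A := \int[mu]_(x in A) (f x)%:E.
have m0 : m set0 = 0 by rewrite /m integral_set0.
have mge0 A : 0 <= m A by apply: integral_ge0 => x _; rewrite lee_fin.
have madd : semi_sigma_additive m.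
  move=> /= F mF tF mUF; rewrite /m; apply: cvg_toP.
    apply: ereal_nondecreasing_is_cvgn => i j ij.
    by apply: lee_sum_nneg_natr => // k _ _; exact: mge0.
  rewrite ge0_integral_bigcup//.
  - by apply/measurable_EFinP; exact: measurable_funTS.
  - by move=> x _; rewrite lee_fin.
pose M := isMeasure.Build _ _ _ m m0 mge0 madd.
pose nu : {measure set T -> \bar R} := HB.pack m M.
by exists nu.
Qed.

End density.

(** Turns finite total mass into the structure needed for product measures and Tonelli's theorem. *)
Lemma finite_measure_of d (T : measurableType d) (R : realType)
    (mu : {measure set T -> \bar R}) : (mu setT < +oo)%E ->
  exists nu : {finite_measure set T -> \bar R}, forall A, nu A = mu A.
Proof.
case: mu => m c; set mu := Measure.Pack c => muT.
have fin : fin_num_fun mu.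
  move=> A mA; rewrite ge0_fin_numE//; apply: le_lt_trans muT.
  by apply: le_measure; rewrite ?inE.
pose M := Measure_isFinite.Build _ _ _ (Measure.Pack c) fin.
pose nu : {finite_measure set T -> \bar R} := HB.pack m (Measure.Pack c) M.
by exists nu.
Qed.

(** * Laplace transforms of measures *)

(* The measure may charge the negative half-line: this makes [2 `^ (c * s)] a Laplace
   transform (of a Dirac mass at [- (c * ln 2)]). *)
Definition laplace (R : realType) (f : R -> R) : Prop :=
  exists mu : {measure set (measurableTypeR R) -> \bar R},
    forall s, 0 <= s -> (\int[mu]_x (expR (- (s * x)))%:E = (f s)%:E)%E.

Lemma measurable_expRNM (R : realType) (s : R) :
  measurable_fun setT (fun x : measurableTypeR R => (expR (- (s * x)))%:E).
Proof.
apply/measurable_EFinP; apply: measurableT_comp => //.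
by apply: measurableT_comp => //; exact: measurable_funM.
Qed.

Lemma eq_laplace (R : realType) (f g : R -> R) :
  (forall s, 0 <= s -> f s = g s) -> laplace f -> laplace g.
Proof. by move=> fg [mu h]; exists mu => s s0; rewrite h// fg. Qed.

(** The product is represented by the convolution, the image of the product measure under
    addition. *)
Lemma laplaceM (R : realType) (f g : R -> R) :
  laplace f -> laplace g -> laplace (fun s => f s * g s).
Proof.
move=> [mu hmu] [nu hnu].
(* At s = 0 the transform is the total mass, which is therefore finite. *)
have fin (m : {measure set (measurableTypeR R) -> \bar R}) h :
    (forall s, 0 <= s -> (\int[m]_x (expR (- (s * x)))%:E = (h s)%:E)%E) ->
    (m setT < +oo)%E.
  move=> /(_ 0 (lexx _)).
  under eq_integral do rewrite mul0r oppr0 expR0.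
  by rewrite integral_cst// mul1e => ->; rewrite ltry.
have [m1 m1E] := finite_measure_of (fin _ _ hmu).
have [m2 m2E] := finite_measure_of (fin _ _ hnu).
have {}hmu s : 0 <= s -> (\int[m1]_x (expR (- (s * x)))%:E = (f s)%:E)%E.
  by move=> s0; rewrite -hmu//; apply: eq_measure_integral => A _ _; exact: m1E.
have {}hnu s : 0 <= s -> (\int[m2]_x (expR (- (s * x)))%:E = (g s)%:E)%E.
  by move=> s0; rewrite -hnu//; apply: eq_measure_integral => A _ _; exact: m2E.
pose phi (z : measurableTypeR R * measurableTypeR R) : measurableTypeR R := z.1 + z.2.
have mphi : measurable_fun setT phi.
  by apply: measurable_funD; [exact: measurable_fst|exact: measurable_snd].
exists (pushforward (m1 \x m2)%E phi) => s s0.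
rewrite ge0_integral_pushforward//; last exact: measurable_expRNM.
rewrite preimage_setT fubini_tonelli1//; last 2 first.
- exact: (measurableT_comp (measurable_expRNM s) mphi).
- by move=> z /=; rewrite lee_fin expR_ge0.
transitivity (\int[m1]_x ((expR (- (s * x)))%:E * (g s)%:E))%E.
  apply: eq_integral => x _; rewrite /fubini_F/= -hnu// -ge0_integralZl//.
    by apply: eq_integral => y _; rewrite -EFinM -expRD mulrDr opprD.
  exact: measurable_expRNM.
rewrite ge0_integralZr//.
- by rewrite hmu// EFinM.
- exact: measurable_expRNM.
- by rewrite -hnu//; apply: integral_ge0 => y _; rewrite lee_fin expR_ge0.
Unshelve. all: exact: mphi. Qed.

Lemma laplace_dirac (R : realType) (a : R) : laplace (fun s => expR (- (s * a))).
Proof.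
exists (\d_(a : measurableTypeR R)) => s s0.
rewrite integral_dirac//; last exact: measurable_expRNM.
by rewrite diracT mul1e.
Qed.

Lemma laplace_cst (R : realType) (c : R) : 0 <= c -> laplace (fun=> c).
Proof.
move=> c0; exists (mscale (NngNum c0) (\d_(0 : measurableTypeR R))) => s s0.
rewrite ge0_integral_mscale//; last exact: measurable_expRNM.
rewrite integral_dirac//; last exact: measurable_expRNM.
by rewrite diracT mul1e mulr0 oppr0 expR0 mule1.
Qed.

Lemma laplaceZ (R : realType) (c : R) (f : R -> R) : 0 <= c ->
  laplace f -> laplace (fun s => c * f s).
Proof. by move=> c0 lf; apply: (@laplaceM _ (fun=> c)) => //; exact: laplace_cst. Qed.

Lemma laplaceX (R : realType) (f : R -> R) n :
  laplace f -> laplace (fun s => f s ^+ n).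
Proof.
move=> lf; elim: n => [|n IH]; first exact: laplace_cst.
apply: (@eq_laplace _ (fun s => f s * f s ^+ n)); last exact: laplaceM.
by move=> s s0; rewrite exprS.
Qed.

(** The representing measures are added up; nonnegative integrands let the integral commute with the
    series. *)
Lemma laplace_series (R : realType) (F : nat -> R -> R) (g : R -> R) :
  (forall k, laplace (F k)) ->
  (forall s, 0 <= s -> series (F ^~ s) @ \oo --> g s) -> laplace g.
Proof.
move=> /choice[mu hmu] cF; exists (mseries mu 0) => s s0.
rewrite ge0_integral_measure_series//; last exact: measurable_expRNM.
apply/cvg_lim => //.
under eq_fun => n do under eq_bigr => k _ do rewrite hmu//.
under eq_fun do rewrite sumEFin.
apply/fine_cvgP; split; first exact: nearW.
exact: cF.
Qed.

Lemma laplace_expR (R : realType) (f : R -> R) :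
  laplace f -> laplace (fun s => expR (f s)).
Proof.
move=> lf; apply: (@laplace_series _ (fun k s => f s ^+ k / k`!%:R)) => [k|s s0].
  apply: (@eq_laplace _ (fun s => k`!%:R^-1 * f s ^+ k)).
    by move=> s s0; rewrite mulrC.
  by apply: laplaceZ => //; exact: laplaceX.
exact: is_cvg_series_exp_coeff.
Qed.

Lemma is_derive_exprf (R : realType) (f : R -> R) n (x df : R) :
  is_derive x 1 f df ->
  is_derive x 1 (fun y => f y ^+ n) (n%:R * f x ^+ n.-1 * df).
Proof. by move=> dfx; rewrite -(exprfctE f); exact: is_deriveX. Qed.

(** The remainder after n terms vanishes at 0 and has derivative x^n / (1-x), so the mean value
    theorem traps it between 0 and u^n u / (1-u). *)
Lemma cvg_series_ln (R : realType) (u : R) : 0 <= u < 1 ->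
  series (fun k => u ^+ k.+1 / k.+1%:R) @ \oo --> - ln (1 - u).
Proof.
move=> /andP[u0 u1].
pose S n (x : R) := \sum_(0 <= k < n) x ^+ k.+1 / k.+1%:R.
have dS n (x : R) : x < 1 ->
    is_derive x 1 (fun x => - ln (1 - x) - S n x) (x ^+ n / (1 - x)).
  move=> x1; elim: n => [|n IH].
    have d1 : is_derive x 1 (fun x : R => 1 - x) (- 1).
      by apply: is_derive_eq; rewrite add0r mul1r.
    have x10 : 0 < 1 - x by rewrite subr_gt0.
    have d2 := @is_derive1_comp R (@ln R) (fun x => 1 - x) x _ _ (is_derive1_ln x10) d1.
    have -> : (fun x => - ln (1 - x) - S 0 x) = - (@ln R \o (fun x => 1 - x)).
      by apply/funext => y; rewrite /S big_nil subr0.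
    by apply: is_derive_eq; rewrite expr0 mulrN1 opprK mul1r.
  have -> : (fun x => - ln (1 - x) - S n.+1 x) =
      (fun x => (- ln (1 - x) - S n x) - n.+1%:R^-1 * x ^+ n.+1).
    apply/funext => y; rewrite /S big_nat_recr//= opprD addrA.
    by congr (_ - _); rewrite mulrC.
  have d3 : is_derive x 1 (fun x : R => n.+1%:R^-1 * x ^+ n.+1) (x ^+ n).
    have e := is_derive_exprf n.+1 (is_derive_id x (1 : R)).
    have := @is_deriveZ _ _ _ (fun x : R => x ^+ n.+1) n.+1%:R^-1 x 1 _ e.
    by rewrite /GRing.scale/= mulr1 mulrA mulVf ?mul1r.
  have <- : x ^+ n / (1 - x) - x ^+ n = x ^+ n.+1 / (1 - x).
    by rewrite exprS; field; rewrite subr_eq0 gt_eqF.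
  exact: is_deriveB IH d3.
have phi0 n : - ln (1 - 0) - S n 0 = 0 :> R.
  rewrite subr0 ln1 oppr0 sub0r /S big1_seq ?oppr0// => k _.
  by rewrite expr0n mul0r.
have bd n : 0 <= - ln (1 - u) - S n u <= u ^+ n * (u / (1 - u)).
  have [x xu||c cu] := @MVT_segment R (fun x => - ln (1 - x) - S n x)
      (fun x => x ^+ n / (1 - x)) 0 u u0.
  - apply: dS; move: xu; rewrite in_itv/= => /andP[_ xu].
    exact: lt_trans xu u1.
  - apply: derivable_within_continuous => x.
    rewrite in_itv/= => /andP[_ xu].
    have := dS n x (le_lt_trans xu u1) => ?; exact: ex_derive.
  rewrite phi0 subr0 subr0 => ->.
  move: cu; rewrite in_itv/= => /andP[c0 cu].
  have c1 : c < 1 := le_lt_trans cu u1.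
  apply/andP; split.
    by rewrite mulr_ge0// divr_ge0 ?exprn_ge0// subr_ge0 ltW.
  rewrite [leRHS]mulrA [leRHS]mulrAC; apply: ler_wpM2r => //; apply: ler_pM.
  - exact: exprn_ge0.
  - by rewrite invr_ge0 subr_ge0 ltW.
  - by rewrite lerXn2r ?nnegrE.
  - by rewrite lef_pV2 ?posrE ?subr_gt0// lerB.
apply: (@squeeze_cvgr _ _ _ _ (fun n => - ln (1 - u) - u ^+ n * (u / (1 - u)))
  (cst (- ln (1 - u)))).
- near=> n; rewrite seriesEnat/= -/(S n u).
  by have /andP[h1 h2] := bd n; apply/andP; split; lra.
- rewrite -[X in _ --> X]subr0; apply: cvgB; first exact: cvg_cst.
  rewrite -(mul0r (u / (1 - u))); apply: cvgMl.
  by apply: cvg_expr; rewrite ger0_norm.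
- exact: cvg_cst.
Unshelve. all: by end_near. Qed.

Lemma laplace_ln (R : realType) (u : R -> R) :
  (forall s, 0 <= s -> 0 <= u s < 1) ->
  laplace u -> laplace (fun s => - ln (1 - u s)).
Proof.
move=> u01 lu.
apply: (@laplace_series _ (fun k s => u s ^+ k.+1 / k.+1%:R)) => [k|s s0].
  apply: (@eq_laplace _ (fun s => k.+1%:R^-1 * u s ^+ k.+1)).
    by move=> s s0; rewrite mulrC.
  by apply: laplaceZ => //; exact: laplaceX.
by apply: cvg_series_ln; exact: u01.
Qed.

Lemma laplace_mellin (R : realType) (f : R -> R) : laplace f ->
  exists mu : {measure set (measurableTypeR R) -> \bar R},
    mu (~` `[0, +oo[%classic) = 0%E /\
    forall s, 0 <= s -> (\int[mu]_(x in `[0%R, +oo[) (x `^ s)%:E = (f s)%:E)%E.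
Proof.
move=> [mu hmu].
pose phi (x : measurableTypeR R) : measurableTypeR R := expR (- x).
have mphi : measurable_fun setT phi by exact: measurableT_comp.
have pT : phi @^-1` `[0, +oo[%classic = setT.
  by apply/seteqP; split => x //= _; rewrite in_itv/= andbT expR_ge0.
exists (pushforward mu phi); split.
  rewrite /= /pushforward [X in mu X](_ : _ = set0) ?measure0//.
  by apply/seteqP; split => x //=; rewrite in_itv/= andbT expR_ge0.
move=> s s0; rewrite ge0_integral_pushforward//; last 2 first.
- by apply/measurable_EFinP/measurable_funTS; exact: measurable_powR.
- by move=> x _; rewrite lee_fin powR_ge0.
rewrite pT -hmu//; apply: eq_integral => x _.
by rewrite /= /phi -expRM mulNr mulrC.
Unshelve. all: exact: mphi. Qed.

(** The measure has as density a^(-p) times the Gamma density of shape p and rate a. *)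
Lemma laplace_powRN (R : realType) (a p : R) : 0 < a -> 0 < p ->
  laplace (fun s => (s + a) `^ (- p)).
Proof.
move=> a0 p0; have G0 := Gamma_gt0 p0.
pose g (t : R) := (Gamma p)^-1 * (t `^ (p - 1) * expR (- (a * t))).
pose f := g \_ `]0, +oo[%classic.
have g0 t : 0 <= g t.
  by rewrite mulr_ge0 ?invr_ge0 ?(ltW G0)// mulr_ge0 ?powR_ge0 ?expR_ge0.
have mexp (s : R) : measurable_fun setT (fun t : R => expR (- (s * t))).
  by apply: measurableT_comp => //; apply: measurableT_comp => //.
have mg : measurable_fun setT g.
  by apply: measurable_funM => //; apply: measurable_funM => //.
have mf : measurable_fun setT f.
  by apply/(measurable_restrict g _) => //; apply: measurable_funTS.
have f0 t : 0 <= f t by apply: restrict_ge0 => x _; exact: g0.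
have [nu hnu] := density_measure (@lebesgue_measure R) mf f0.
exists nu => s s0.
rewrite (@ge0_integral_density _ (measurableTypeR R) R (@lebesgue_measure R) nu f
  mf f0 hnu)//; last exact: measurable_expRNM.
have sa0 : 0 < s + a by rewrite ltr_wpDl.
transitivity (\int[@lebesgue_measure R]_(x in `]0%R, +oo[)
    ((Gamma p)^-1%:E * (x `^ (p - 1) * expR (- ((s + a) * x)))%:E))%E.
  rewrite [RHS]integral_mkcond; apply: eq_integral => x _.
  rewrite /f !patchE; case: ifPn => _; last by rewrite mule0.
  rewrite -!EFinM; congr EFin; rewrite /g mulrDl opprD expRD.
  by ring.
rewrite ge0_integralZl//; last 3 first.
- apply/measurable_EFinP/measurable_funTS; apply: measurable_funM => //.
  exact: mexp.
- by move=> x _; rewrite lee_fin mulr_ge0 ?powR_ge0 ?expR_ge0.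
- by rewrite lee_fin invr_ge0 ltW.
rewrite egamma_scale// -EFin_Gamma// -!EFinM; congr EFin.
by rewrite mulrCA mulVf ?mulr1// gt_eqF.
Qed.

(** * Real powers of the Gamma ratio as Laplace transforms *)

Lemma laplace_ln_gratioq (R : realType) : laplace (fun s : R => ln (gratioq s)).
Proof.
apply: (@laplace_series _ (fun k s => - ln (1 - (4 * (s + k.+1%:R) ^+ 2)^-1)));
  last by move=> s s0; exact: cvg_series_ln_gratioq.
move=> k; apply: laplace_ln.
  (* Starting at k + 1 keeps u at most 1/4, inside the disc of the logarithmic series. *)
  move=> s s0; have k1 : 1 <= s + k.+1%:R.
    by rewrite -[leLHS]add0r lerD// ler1n.
  have k2 : 1 <= (s + k.+1%:R) ^+ 2 by rewrite exprn_ege1.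
  rewrite invr_ge0 mulr_ge0 ?sqr_ge0//= invf_lt1; last by lra.
  by lra.
apply: (@eq_laplace _ (fun s => 4^-1 * (s + k.+1%:R) `^ (- 2%:R))).
  by move=> s s0; rewrite powR_invn ?addr_ge0// [RHS]invfM.
by apply: laplaceZ; [rewrite invr_ge0|exact: laplace_powRN].
Qed.

Lemma laplace_gratio_powR (R : realType) (c : R) : 0 < c ->
  laplace (fun s => gratio s `^ c).
Proof.
move=> c0.
apply: (@eq_laplace _ (fun s => expR (c / 2 * ln (gratioq s)) *
    (s + 1 / 2) `^ (- (c / 2)))).
  move=> s s0; have g0 := gratio_gt0 s0.
  have h0 : 0 < s + 1 / 2 by lra.
  rewrite /powR !gt_eqF// -expRD; congr expR.
  rewrite /gratioq lnM ?posrE ?exprn_gt0// lnXn//.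
  by move: (ln _) (ln _) => x y; field.
apply: laplaceM; last by apply: laplace_powRN; rewrite divr_gt0.
apply: laplace_expR; apply: laplaceZ; first by rewrite divr_ge0// ltW.
exact: laplace_ln_gratioq.
Qed.

Lemma laplace_Bbar (R : realType) (c : R) : 0 < c ->
  laplace (fun s => (2 `^ s / Num.sqrt pi * gratio s) `^ c).
Proof.
move=> c0.
apply: (@eq_laplace _ (fun s => expR (- (s * - (c * ln 2))) *
    ((Num.sqrt pi)^-1 `^ c * gratio s `^ c))).
  move=> s s0; have g0 := gratio_gt0 s0.
  have P0 : 0 < Num.sqrt pi :> R by rewrite sqrtr_gt0 pi_gt0.
  rewrite [RHS]powRM; last 2 first.
  - by rewrite mulr_ge0 ?powR_ge0 ?invr_ge0 ?(ltW P0).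
  - exact: ltW g0.
  rewrite powRM ?powR_ge0 ?invr_ge0 ?(ltW P0)// mulrA.
  congr (_ * _ * _); rewrite -powRrM /powR pnatr_eq0/=.
  by congr expR; ring.
apply: laplaceM; first exact: laplace_dirac.
apply: laplaceZ; first exact: powR_ge0.
exact: laplace_gratio_powR.
Qed.

Lemma Bbar_mellin_measure (R : realType) (c : R) : 0 < c ->
  exists mu : {measure set (measurableTypeR R) -> \bar R},
    mu (~` `[0, +oo[%classic) = 0%E /\
    forall s, 0 <= s -> (\int[mu]_(x in `[0%R, +oo[) (x `^ s)%:E =
      ((2 `^ s / Num.sqrt pi * (Gamma (s + 1 / 2) / Gamma (s + 1))) `^ c)%:E)%E.
Proof. by move=> c0; exact/laplace_mellin/laplace_Bbar. Qed.

Lemma mellin_stieltjes_moments (R : realType) (c : R)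
    (mu : {measure set (measurableTypeR R) -> \bar R}) :
  mu (~` `[0, +oo[%classic) = 0%E ->
  (forall s, 0 <= s -> (\int[mu]_(x in `[0%R, +oo[) (x `^ s)%:E =
      ((2 `^ s / Num.sqrt pi * (Gamma (s + 1 / 2) / Gamma (s + 1))) `^ c)%:E)%E) ->
  has_stieltjes_moments mu (fun n => Bbar R n `^ c).
Proof.
move=> mu0 h; split => // n; rewrite -gratio_nat -h//.
apply: eq_integral => x; rewrite inE/= in_itv/= andbT => x0.
by rewrite powR_mulrn.
Qed.

(** * Determinacy of bounded moment sequences *)

Lemma bernoulli_ineq (R : realType) (y : R) n : 0 <= y <= 1 ->
  1 - n%:R * y <= (1 - y) ^+ n.
Proof.
move=> /andP[y0 y1]; elim: n => [|n IH]; first by rewrite mul0r subr0 expr0.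
have n0 := ler0n R n; rewrite exprS -[n.+1%:R]natr1.
have y10 : 0 <= 1 - y by rewrite subr_ge0.
apply: le_trans (ler_wpM2l y10 IH).
move: (n%:R : R) n0 => m m0; nra.
Qed.

Lemma bernoulli_ineq_inv (R : realType) (y : R) n : 0 <= y <= 1 ->
  (1 - y) ^+ n * (1 + n%:R * y) <= 1.
Proof.
move=> /andP[y0 y1]; elim: n => [|n IH]; first by rewrite mul0r addr0 expr0 mulr1.
apply: le_trans IH; rewrite exprSr -mulrA.
have y10 : 0 <= (1 - y) ^+ n by rewrite exprn_ge0// subr_ge0.
apply: ler_wpM2l => //.
have n0 := ler0n R n; rewrite -[n.+1%:R]natr1.
move: (n%:R : R) n0 => m m0; nra.
Qed.

Lemma cvg_nX (R : realType) (z : R) : 0 <= z < 1 ->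
  n%:R * z ^+ n @[n --> \oo] --> (0 : R).
Proof.
(* One factor u^n keeps n u^n bounded, by the upper Bernoulli estimate; the other factor u^n tends
   to 0. *)
move=> /andP[z0 z1]; pose u := Num.sqrt z.
have u0 : 0 <= u by exact: sqrtr_ge0.
have zE : z = u ^+ 2 by rewrite sqr_sqrtr.
have u1 : u < 1.
  by rewrite -(@ltr_pXn2r _ 2)// ?nnegrE// expr1n -zE.
clearbody u.
have h0 : 0 < 1 - u by rewrite subr_gt0.
have bd n : n%:R * u ^+ n <= (1 - u)^-1.
  have u01 : 0 <= 1 - u <= 1 by rewrite subr_ge0 ltW//= lerBlDr lerDl.
  have := bernoulli_ineq_inv n u01; rewrite subKr => h.
  rewrite -[leRHS]div1r ler_pdivlMr//; apply: le_trans h.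
  rewrite -mulrA mulrCA ler_wpM2l ?exprn_ge0// lerDr//.
apply: (@squeeze_cvgr _ _ _ _ (cst 0) (fun n => (1 - u)^-1 * u ^+ n)).
- near=> n; rewrite mulr_ge0 ?exprn_ge0//=.
  by rewrite zE -exprM mulnC exprM expr2 mulrA ler_wpM2r ?exprn_ge0.
- exact: cvg_cst.
- rewrite -(mulr0 (1 - u)^-1); apply: cvgMr.
  by apply: cvg_expr; rewrite ger0_norm.
Unshelve. all: by end_near. Qed.

(** Exponent times x^n is n (2x)^n, which tends to 0 for x < 1/2 and is at least n for x >= 1/2; the
    two Bernoulli estimates turn this into the limits 1 and 0. The factor n in the exponent settles
    the point 1/2 itself. *)
Definition step_fun (R : realType) n (x : R) : R :=
  (1 - x ^+ n) ^+ (n * 2 ^ n).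

Lemma step_fun_itv (R : realType) n (x : R) : 0 <= x <= 1 ->
  0 <= step_fun n x <= 1.
Proof.
move=> /andP[x0 x1].
have y0 : 0 <= x ^+ n by exact: exprn_ge0.
have y1 : x ^+ n <= 1 by exact: exprn_ile1.
rewrite /step_fun exprn_ge0 ?subr_ge0//=.
by rewrite exprn_ile1 ?subr_ge0// lerBlDr lerDl.
Qed.

Lemma cvg_step_fun (R : realType) (x : R) : 0 <= x <= 1 ->
  step_fun n x @[n --> \oo] --> ((x < 1 / 2)%R%:R : R).
Proof.
move=> x01; have /andP[x0 x1] := x01.
have y0 n : 0 <= x ^+ n by exact: exprn_ge0.
have y1 n : x ^+ n <= 1 by exact: exprn_ile1.
have y01 n : 0 <= x ^+ n <= 1 by rewrite y0 y1.
have kE n : (n * 2 ^ n)%:R * x ^+ n = n%:R * (2 * x) ^+ n.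
  by rewrite natrM natrX -mulrA exprMn.
have [xh|xh] := ltP x (1 / 2).
- apply: (@squeeze_cvgr _ _ _ _ (fun n => 1 - n%:R * (2 * x) ^+ n) (cst 1)).
  + near=> n; have /andP[_ ->] := step_fun_itv n x01; rewrite andbT.
    by rewrite -kE; exact: bernoulli_ineq.
  + rewrite -[X in _ --> X]subr0; apply: cvgB; first exact: cvg_cst.
    by apply: cvg_nX; lra.
  + exact: cvg_cst.
- rewrite -(cvg_shiftS (fun n => step_fun n x)).
  apply: (@squeeze_cvgr _ _ _ _ (cst 0) (fun n => n.+1%:R^-1)).
  + near=> n; have /andP[s0 _] := step_fun_itv n.+1 x01; rewrite s0/=.
    have := bernoulli_ineq_inv (n.+1 * 2 ^ n.+1) (y01 n.+1).
    rewrite -/(step_fun n.+1 x) kE => h.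
    rewrite -[leRHS]div1r ler_pdivlMr//; apply: le_trans h.
    rewrite ler_wpM2l// -[leLHS]add0r lerD// -[leLHS]mulr1 ler_wpM2l//.
    by rewrite exprn_ege1//; lra.
  + exact: cvg_cst.
  + exact: cvg_harmonic.
Unshelve. all: by end_near. Qed.

Lemma measure_eq_rays (R : realType)
    (mu nu : {measure set (measurableTypeR R) -> \bar R}) :
  (mu setT < +oo)%E -> (forall a, mu `]-oo, a[%classic = nu `]-oo, a[%classic) ->
  forall A, measurable A -> mu A = nu A.
Proof.
move=> muT h; apply: (@measure_unique _ R (measurableTypeR R) (@RGenInftyO.G R)
  (fun n => `]-oo, n%:R[%classic)).
- exact: RGenInftyO.measurableE.
- move=> A B [a ->] [b ->]; exists (Num.min a b).
  by apply/seteqP; split => x /=; rewrite !in_itv/= lt_min => /andP.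
- by move=> n; exists n%:R.
- apply/seteqP; split => // x _; exists (Num.truncn `|x|).+1 => //=.
  by rewrite in_itv/= (le_lt_trans (ler_norm _))// truncnS_gt.
- by move=> A [a ->]; exact: h.
- move=> n; apply: le_lt_trans muT.
  by apply: le_measure; rewrite ?inE//.
Qed.

Lemma eq_integral_null_sets (R : realType)
    (mu : {measure set (measurableTypeR R) -> \bar R})
    (A B : set (measurableTypeR R)) (f : measurableTypeR R -> \bar R) :
  measurable A -> measurable B -> measurable_fun setT f ->
  mu (A `\` B) = 0%E -> mu (B `\` A) = 0%E ->
  (\int[mu]_(x in A) f x = \int[mu]_(x in B) f x)%E.
Proof.
move=> mA mB mf AB BA; rewrite integral_mkcond [RHS]integral_mkcond.
apply: ae_eq_integral => //.
- by apply/(measurable_restrictT _ mA); exact: measurable_funTS.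
- by apply/(measurable_restrictT _ mB); exact: measurable_funTS.
exists ((A `\` B) `|` (B `\` A)); split.
- by apply: measurableU; exact: measurableD.
- by rewrite null_set_setU//; exact: measurableD.
- move=> x /= /not_implyP[_]; rewrite /patch.
  by case: ifPn; case: ifPn; rewrite ?inE ?notin_setE => xB xA //; [left|right].
Qed.

(** Markov's inequality with even powers: if r > K, the mass of |x| >= r is at most (K/r)^(2n) for
    every n. The values r = K + 1/(j+1) exhaust the complement. *)
Lemma null_of_moments (R : realType)
    (mu : {measure set (measurableTypeR R) -> \bar R}) (K : R) : 0 < K ->
  (forall n, (\int[mu]_x (x ^+ n.*2)%:E <= (K ^+ n.*2)%:E)%E) ->
  mu (~` `[- K, K]%classic) = 0%E.
Proof.
move=> K0 hK.
pose F j := [set x : R | K + j.+1%:R^-1 <= `|x|].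
have mF j : measurable (F j : set (measurableTypeR R)).
  rewrite -[X in measurable X]setTI.
  exact: (measurable_fun_ler (measurable_cst _) (@normr_measurable _ _)).
have F0 j : mu (F j) = 0%E.
  pose r := K + j.+1%:R^-1.
  have r0 : 0 < r by rewrite addr_gt0.
  have bd n : (mu (F j) <= ((K / r) ^+ n.*2)%:E)%E.
    rewrite expr_div_n mulrC EFinM lee_pdivlMl ?exprn_gt0//.
    apply: le_trans (hK n).
    rewrite -integral_cst//.
    apply: (@le_trans _ _ (\int[mu]_(x in F j) (x ^+ n.*2)%:E)%E).
      apply: ge0_le_integral => //.
      - by move=> x _; rewrite lee_fin exprn_ge0 ?ltW.
      - by apply/measurable_EFinP/measurable_funTS; exact: measurable_funX.
      - move=> x Fx; rewrite lee_fin -mul2n !exprM lerXn2r ?nnegrE ?sqr_ge0//.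
        by rewrite -[leRHS]real_normK ?num_real// lerXn2r ?nnegrE// ltW.
    apply: ge0_subset_integral => //.
    - by apply/measurable_EFinP; exact: measurable_funX.
    - by move=> x _; rewrite lee_fin -mul2n exprM exprn_ge0 ?sqr_ge0.
  apply/eqP; rewrite eq_le measure_ge0 andbT.
  apply: (@lee_cvg_to _ (\oo : set_system nat) _ R (cst (mu (F j)))
    (fun n => ((K / r) ^+ n.*2)%:E)).
  - exact: cvg_cst.
  - apply/fine_cvgP; split; first exact: nearW.
    under eq_fun do rewrite -mul2n exprM.
    apply: cvg_expr; rewrite ger0_norm ?sqr_ge0// exprn_ilt1//.
      by rewrite divr_ge0// ltW.
    by rewrite ltr_pdivrMr// mul1r /r ltrDl.
  - exact: nearW.
have -> : ~` `[- K, K]%classic = \bigcup_j F j.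
  apply/seteqP; split => x /=.
    rewrite in_itv/= -ler_norml => /negP; rewrite -ltNge => Kx.
    have /ltr_add_invr[j jx] := Kx.
    by exists j => //; rewrite /F/= ltW.
  move=> [j _]; rewrite /F/= in_itv/= -ler_norml => h.
  apply/negP; rewrite -ltNge; apply: lt_le_trans h.
  by rewrite ltrDl.
apply/negligibleP; first exact: bigcup_measurable.
by apply: negligible_bigcup => j; apply/negligibleP; [exact: mF|exact: F0].
Qed.

Lemma eq_integral_horner (R : realType)
    (mu nu : {measure set (measurableTypeR R) -> \bar R}) (K : R) (m : nat -> R) :
  (forall n, \int[mu]_(x in `[(- K)%R, K]) (x ^+ n)%:E = (m n)%:E)%E ->
  (forall n, \int[nu]_(x in `[(- K)%R, K]) (x ^+ n)%:E = (m n)%:E)%E ->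
  (mu setT < +oo)%E -> (nu setT < +oo)%E ->
  forall p : {poly R}, (\int[mu]_(x in `[(- K)%R, K]) (p.[x])%:E =
    \int[nu]_(x in `[(- K)%R, K]) (p.[x])%:E)%E.
Proof.
move=> hmu hnu muT nuT.
have int (l : {measure set (measurableTypeR R) -> \bar R}) (p : {poly R}) :
    (l setT < +oo)%E -> l.-integrable `[- K, K]%classic (fun x => (p.[x])%:E).
  move=> lT; apply: measurable_bounded_integrable => //.
  - apply: le_lt_trans lT.
    by apply: le_measure; rewrite ?inE.
  - apply: measurable_funTS.
    by apply: continuous_measurable_fun; exact: continuous_horner.
  - have : compact [set p.[x] | x in `[- K, K]%classic].
      apply: continuous_compact; last exact: segment_compact.
      by apply: continuous_subspaceT; exact: continuous_horner.
    move=> /compact_bounded[M [Mr h]]; exists M; split => // N MN x /= xK.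
    by apply: h => //; exists x.
move=> p.
(* Induction peels p off as p X + c, so the statement must allow a monomial factor, whose exponent
   grows by one at each step. *)
suff h n : (\int[mu]_(x in `[(- K)%R, K]) ((p * 'X^n).[x])%:E =
    \int[nu]_(x in `[(- K)%R, K]) ((p * 'X^n).[x])%:E)%E.
  by have := h 0%N; rewrite expr0 mulr1.
elim/poly_ind: p n => [|p c IH] n.
  by rewrite mul0r; under eq_integral do rewrite horner0;
    under [RHS]eq_integral do rewrite horner0; rewrite !integral0.
pose r : {poly R} := (p * 'X + c%:P) * 'X^n; pose r' : {poly R} := p * 'X^(n.+1).
have E (l : {measure set (measurableTypeR R) -> \bar R}) : (l setT < +oo)%E ->
    (forall n, \int[l]_(x in `[(- K)%R, K]) (x ^+ n)%:E = (m n)%:E)%E ->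
    (\int[l]_(x in `[(- K)%R, K]) (r.[x])%:E =
     \int[l]_(x in `[(- K)%R, K]) (r'.[x])%:E + c%:E * (m n)%:E)%E.
  move=> lT hl; rewrite -hl -integralZl//; last first.
    apply: eq_integrable (int l 'X^n lT) => //.
    by move=> x _; rewrite hornerXn.
  rewrite -integralD//; last 2 first.
  - exact: int.
  - apply: eq_integrable (int l (c%:P * 'X^n) lT) => //.
    by move=> x _; rewrite hornerM hornerC hornerXn EFinM.
  apply: eq_integral => x _; rewrite -EFinM -EFinD; congr EFin.
  by rewrite /r /r' !hornerE exprS; ring.
by rewrite -/r !E// /r' IH.
Qed.

Lemma measure_setC0 (R : realType)
    (mu : {measure set (measurableTypeR R) -> \bar R}) (A D : set R) :
  measurable A -> measurable D -> mu (~` D) = 0%E -> mu A = mu (A `&` D).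
Proof.
move=> mA mD muD.
rewrite (measureDI mu mA mD) [X in (X + _)%E](_ : _ = 0%E) ?add0e//.
apply/eqP; rewrite eq_le measure_ge0 andbT -muD; apply: le_measure.
- by rewrite inE; exact: measurableD.
- by rewrite inE; exact: measurableC.
- by move=> x [].
Qed.

Lemma moment_determinacy (R : realType)
    (mu nu : {measure set (measurableTypeR R) -> \bar R}) (K : R) (m : nat -> R) :
  0 < K ->
  (forall n, \int[mu]_x (x ^+ n)%:E = (m n)%:E)%E ->
  (forall n, \int[nu]_x (x ^+ n)%:E = (m n)%:E)%E ->
  (forall n, m n.*2 <= K ^+ n.*2) ->
  forall A, measurable A -> mu A = nu A.
Proof.
move=> K0 hmu hnu mK.
have fin (l : {measure set (measurableTypeR R) -> \bar R}) :
    (forall n, \int[l]_x (x ^+ n)%:E = (m n)%:E)%E -> (l setT < +oo)%E.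
  move=> /(_ 0%N); under eq_integral do rewrite expr0.
  by rewrite integral_cst// mul1e => ->; rewrite ltry.
have null (l : {measure set (measurableTypeR R) -> \bar R}) :
    (forall n, \int[l]_x (x ^+ n)%:E = (m n)%:E)%E ->
    l (~` `[- K, K]%classic) = 0%E.
  by move=> hl; apply: null_of_moments => // n; rewrite hl lee_fin.
have hD (l : {measure set (measurableTypeR R) -> \bar R}) :
    (forall n, \int[l]_x (x ^+ n)%:E = (m n)%:E)%E ->
    forall n, (\int[l]_(x in `[(- K)%R, K]) (x ^+ n)%:E = (m n)%:E)%E.
  move=> hl n; rewrite -hl; apply: eq_integral_null_sets => //.
  - by apply/measurable_EFinP; exact: measurable_funX.
  - by rewrite setDT measure0.
  - by rewrite setTD null.
have hp := eq_integral_horner (hD _ hmu) (hD _ hnu) (fin _ hmu) (fin _ hnu).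
apply: measure_eq_rays; first exact: fin.
move=> a.
(* On [-K, K] one has |x - a| <= 2L, so division by 4L and centring at 1/2 land in [0, 1], and the
   threshold 1/2 corresponds to x = a. *)
pose L := Num.max K `|a|.
have L0 : 0 < L by rewrite lt_max K0.
pose y (x : R) := 1 / 2 + (x - a) / (4 * L).
have yP x : `[- K, K]%classic x -> 0 <= y x <= 1.
  rewrite /= in_itv/= => /andP[xl xu].
  have KL : K <= L by rewrite le_max lexx.
  have aL : `|a| <= L by rewrite le_max lexx orbT.
  have /andP[al au] : - L <= a <= L by rewrite -ler_norml.
  have : - (1 / 2) <= (x - a) / (4 * L) <= 1 / 2.
    rewrite ler_pdivlMr ?mulr_gt0// ler_pdivrMr ?mulr_gt0//.
    by apply/andP; split; lra.
  by rewrite /y; lra.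
have yE x : (y x < 1 / 2) = (x < a).
  by rewrite /y -ltrBrDl subrr pmulr_llt0 ?invr_gt0 ?mulr_gt0// subr_lt0.
pose q n : {poly R} := (1 - ((1 / 2 - a / (4 * L))%:P + (4 * L)^-1 *: 'X) ^+ n)
  ^+ (n * 2 ^ n).
have qE n x : (q n).[x] = step_fun n (y x).
  rewrite /q /step_fun !hornerE.
  by congr ((1 - _ ^+ _) ^+ _); rewrite /y; ring.
have cv (l : {measure set (measurableTypeR R) -> \bar R}) :
    (l setT < +oo)%E -> l (~` `[- K, K]%classic) = 0%E ->
    (\int[l]_(x in `[(- K)%R, K]) ((q n).[x])%:E)%E @[n --> \oo] -->
    l `]-oo, a[%classic.
  move=> lT l0.
  have -> : l `]-oo, a[%classic = (\int[l]_(x in `[(- K)%R, K]) ((x < a)%R%:R : R)%:E)%E.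
    rewrite (measure_setC0 _ _ l0)// -integral_indic//; apply: eq_integral => x _.
    by rewrite indicE mem_setE in_itv.
  apply: (@dominated_cvg _ _ _ _ _ _ _ _ (cst 1%E)) => //.
  - move=> n; apply/measurable_EFinP/measurable_funTS.
    by apply: continuous_measurable_fun; exact: continuous_horner.
  - move=> x xK; apply/fine_cvgP; split; first exact: nearW.
    under eq_fun do rewrite /= qE.
    by rewrite -yE; apply: cvg_step_fun; exact: yP.
  - apply/integrableP; split => //.
    under eq_integral do rewrite /= normr1.
    rewrite integral_cst// mul1e; apply: le_lt_trans lT.
    by apply: le_measure; rewrite ?inE.
  - move=> n x xK; rewrite lee_fin qE.
    have /andP[s0 s1] := step_fun_itv n (yP _ xK).
    by rewrite ger0_norm.
apply: (cvg_unique (@ereal_hausdorff R) (cv _ (fin _ hmu) (null _ hmu))) => /=.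
under eq_fun do rewrite hp.
exact: (cv _ (fin _ hnu) (null _ hnu)).
Qed.

(** * The arcsine law *)

Lemma arcsine_density_powR (R : realType) (y : R) : 0 < y < 2 ->
  arcsine_density y = pi^-1 * (y * (2 - y)) `^ (- 2^-1).
Proof.
move=> y02; rewrite /arcsine_density y02 powRN powR12_sqrt ?div1r ?mul1r//.
by have /andP[y0 y2] := y02; rewrite mulr_ge0 ?ltW// subr_gt0.
Qed.

Lemma arcsine_densityE (R : realType) : @arcsine_density R =
  (fun y => pi^-1 * (y * (2 - y)) `^ (- 2^-1)) \_ `]0, 2[%classic.
Proof.
apply/funext => y; rewrite patchE mem_setE in_itv/=.
case: ifPn => [/arcsine_density_powR//|/negbTE h].
by rewrite /arcsine_density h.
Qed.

Lemma arcsine_density_ge0 (R : realType) (y : R) : 0 <= arcsine_density y.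
Proof.
rewrite arcsine_densityE; apply: restrict_ge0 => x _.
by rewrite mulr_ge0 ?powR_ge0 ?invr_ge0 ?pi_ge0.
Qed.

Lemma measurable_arcsine_density (R : realType) :
  measurable_fun setT (@arcsine_density R).
Proof.
rewrite arcsine_densityE.
apply/(measurable_restrict (fun y : R => pi^-1 * (y * (2 - y)) `^ (- 2^-1)) _) => //.
apply: measurable_funTS; apply: measurable_funM => //.
apply: (measurableT_comp (measurable_powR _)).
by apply: measurable_funM => //; exact: measurable_funB.
Qed.

Lemma arcsine_density_continuous (R : realType) (y : R) : 0 < y < 2 ->
  {for y, continuous (@arcsine_density R)}.
Proof.
move=> y02; have /andP[y0 y2] := y02.
have c : {for y, continuous (fun y : R => pi^-1 * (y * (2 - y)) `^ (- 2^-1))}.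
  apply: cvgMr.
  apply: (@continuous_comp _ _ _ (fun y : R => y * (2 - y)) (fun z => z `^ (- 2^-1))).
    apply: continuousM => //; apply: continuousB => //; exact: cst_continuous.
  by apply: powR_continuous; rewrite mulr_gt0// subr_gt0.
rewrite /prop_for /continuous_at (arcsine_density_powR y02).
apply: cvg_trans; last exact: c.
have nE : \forall z \near nbhs y, (`]0, 2[%classic : set R) z.
  by apply: open_nbhs_nbhs; split; [exact: interval_open|rewrite /= in_itv].
apply: near_eq_cvg; apply: filterS nE => z /=; rewrite in_itv/= => z02.
by rewrite arcsine_density_powR.
Qed.

Lemma is_derive_1Bcos (R : realType) (x : R) :
  is_derive x 1 (fun x => 1 - cos x) (sin x).
Proof.
have d := is_deriveB (is_derive_cst (1 : R) x 1) (is_derive_cos x).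
by apply: is_derive_eq d _; rewrite sub0r opprK.
Qed.

Lemma itv0pi_bigcup (R : realType) :
  `]0, pi[%classic = \bigcup_n `[(n.+2%:R^-1 : R), pi - n.+2%:R^-1]%classic.
Proof.
apply/seteqP; split => x /=.
  rewrite in_itv/= => /andP[x0 xpi].
  have /filter_ex[n [n1 n2]] : \forall n \near \oo,
      (n.+2%:R^-1 : R) <= x /\ (n.+2%:R^-1 : R) <= pi - x.
    near=> n; split; near: n; apply: (cvgr_le 0); rewrite ?subr_gt0//.
      exact: cvg_invn2.
    exact: cvg_invn2.
  by exists n => //=; rewrite in_itv/= n1 lerBrDr -lerBrDl.
move=> [n _] /=; rewrite !in_itv/= => /andP[nx xn].
have n0 : 0 < n.+2%:R^-1 :> R by [].
by rewrite (lt_le_trans n0)//= (le_lt_trans xn)// ltrBlDr ltrDl.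
Unshelve. all: by end_near. Qed.

Lemma invn2_itv (R : realType) n :
  0 < (n.+2%:R^-1 : R) /\ n.+2%:R^-1 <= pi - n.+2%:R^-1 :> R.
Proof.
split => //; have : n.+2%:R^-1 <= 2^-1 :> R by rewrite lef_pV2 ?posrE// ler_nat.
have := @pi_ge2 R; move: (n.+2%:R^-1) (pi : R) => z p; lra.
Qed.

(** With y = 1 - cos x one has y (2 - y) = (sin x)^2, so the Jacobian sin x cancels the square root
    and only 1/pi is left. *)
Lemma arcsine_integral (R : realType) (h : R -> R) :
  continuous h -> (forall x, 0 <= h x) ->
  (\int[lebesgue_measure]_x ((h x)%:E * (arcsine_density x)%:E) =
   pi^-1%:E * \int[lebesgue_measure]_(x in `[0%R, pi]) (h (1 - cos x))%:E)%E.
Proof.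
move=> ch h0.
have mh : measurable_fun setT h by exact: continuous_measurable_fun.
have chc : continuous (fun x : R => h (1 - cos x)).
  move=> x; apply: continuous_comp; last exact: ch.
  by apply: continuousB; [exact: cst_continuous|exact: continuous_cos].
have mhc : measurable_fun setT (fun x : R => h (1 - cos x)).
  exact: continuous_measurable_fun.
have pi0 : 0 < pi :> R by exact: pi_gt0.
transitivity (\int[@lebesgue_measure R]_(x in `]0%R, 2%R[)
    (h x * arcsine_density x)%:E)%E.
  rewrite [RHS]integral_mkcond; apply: eq_integral => x _.
  rewrite patchE mem_setE in_itv/=; case: ifPn => [//|/negbTE x02].
  by rewrite /arcsine_density x02 mule0.
have cosE (x : R) : 0 < x -> x < pi -> -1 < cos x < 1.
  move=> x0 xpi; rewrite -cospi -cos0 !ltr_cos ?in_itv/= ?lexx ?ltW//=.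
  by rewrite x0 xpi.
have oE : forall x : R, `]0, pi[%classic x -> 0 < 1 - cos x < 2.
  by move=> x /=; rewrite in_itv/= => /andP[x0 xpi]; have := cosE x x0 xpi; lra.
transitivity (\int[@lebesgue_measure R]_(x in `]0%R, pi[)
    (h (1 - cos x) * arcsine_density (1 - cos x) * sin x)%:E)%E.
  apply: (@integral_substitution_open R (fun x => 1 - cos x) sin
    (fun x => h x * arcsine_density x) (fun n => n.+2%:R^-1)
    (fun n => pi - n.+2%:R^-1)).
  - by move=> n; have [] := @invn2_itv R n.
  - exact: nincr_invn2.
  - by move=> m n mn; rewrite lerB//; exact: nincr_invn2.
  - exact: interval_open.
  - exact: itv0pi_bigcup.
  - apply/seteqP; split => y /=.
      rewrite in_itv/= => /andP[y0 y2].
      have y11 : -1 <= 1 - y <= 1 by lra.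
      have : `]0, pi[%classic (acos (1 - y)).
        by rewrite /= in_itv/= acos_gt0 ?acos_ltpi//; lra.
      rewrite itv0pi_bigcup => -[n _] /=; rewrite in_itv/= => /andP[n1 n2].
      have [n3 n4] := @invn2_itv R n.
      exists n => //=; rewrite in_itv/=.
      have yE : y = 1 - cos (acos (1 - y)).
        by rewrite acosK ?in_itv//= subKr.
      have lec (u v : R) : 0 <= u -> u <= v -> v <= pi -> 1 - cos u <= 1 - cos v.
        move=> u0 uv vpi; rewrite lerB// leNgt ltr_cos ?in_itv/= -?leNgt//.
        - by rewrite (le_trans u0).
        - by rewrite u0 (le_trans uv).
      apply/andP; split.
        rewrite [leRHS]yE; apply: lec => //.
        by rewrite (le_trans n2)// lerBlDr lerDl ltW.
      rewrite [leLHS]yE; apply: lec => //.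
        by rewrite (le_trans _ n1)// ltW.
      by rewrite lerBlDr lerDl ltW.
    move=> [n _] /=; rewrite !in_itv/= => /andP[y1 y2].
    have [n3 n4] := @invn2_itv R n.
    have n5 : n.+2%:R^-1 < pi :> R by rewrite (le_lt_trans n4)// ltrBlDr ltrDl.
    have n6 : pi - n.+2%:R^-1 < pi :> R by rewrite ltrBlDr ltrDl.
    have /andP[_ c1] := cosE _ n3 n5.
    have /andP[c2 _] := cosE _ (lt_le_trans n3 n4) n6.
    by rewrite (lt_le_trans _ y1) ?subr_gt0//= (le_lt_trans y2)//; lra.
  - move=> u v; rewrite !inE/= !in_itv/= => /andP[u0 upi] /andP[v0 vpi] uv.
    by rewrite ltrD2l ltrN2 ltr_cos ?in_itv/= ?(ltW u0) ?(ltW upi) ?(ltW v0) ?(ltW vpi).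
  - by move=> x _; exact: is_derive_1Bcos.
  - by move=> x /=; rewrite in_itv/= => /andP[x0 xpi]; rewrite sin_ge0_pi// !ltW.
  - by move=> x _; exact: continuous_sin.
  - by apply: measurable_funM => //; exact: measurable_arcsine_density.
  - apply: measurable_funM; last first.
      by apply: continuous_measurable_fun; exact: continuous_sin.
    apply: measurable_funM => //.
    apply: (measurableT_comp (@measurable_arcsine_density R)).
    apply: continuous_measurable_fun => x.
    by apply: continuousB; [exact: cst_continuous|exact: continuous_cos].
  - by move=> y _; rewrite mulr_ge0// arcsine_density_ge0.
  - move=> y /=; rewrite in_itv/= => y02; apply: continuousM; first exact: ch.
    exact: arcsine_density_continuous.
transitivity (\int[@lebesgue_measure R]_(x in `]0%R, pi[)
    (pi^-1%:E * (h (1 - cos x))%:E))%E.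
  apply: eq_integral => x; rewrite inE => xpi.
  rewrite -EFinM; congr EFin.
  have y02 := oE _ xpi; move: xpi; rewrite /= in_itv/= => /andP[x0 xpi].
  rewrite /arcsine_density y02.
  have s0 : 0 < sin x by rewrite sin_gt0_pi// x0.
  have -> : (1 - cos x) * (2 - (1 - cos x)) = sin x ^+ 2.
    by rewrite sin2cos2; ring.
  rewrite sqrtr_sqr gtr0_norm//.
  have pn : pi != 0 :> R by rewrite gt_eqF.
  have sn : sin x != 0 by rewrite gt_eqF.
  move: (h _) (sin x) (pi : R) pn sn => u s p pn sn.
  by field; rewrite pn sn.
rewrite ge0_integralZl//; last 3 first.
- by apply/measurable_EFinP/measurable_funTS.
- by move=> x _; rewrite lee_fin.
- by rewrite lee_fin invr_ge0 ltW.
congr (_ * _)%E.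
rewrite integral_itv_bndo_bndc; last exact/measurable_EFinP/measurable_funTS.
by rewrite integral_itv_obnd_cbnd//; exact/measurable_EFinP/measurable_funTS.
Qed.

(** * Reduction formulas on [0, pi] and the Bessel integral *)

Lemma integral_0pi_derive (R : realType) (H h : R -> R) :
  continuous h -> (forall x : R, is_derive x 1 H (h x)) ->
  (\int[lebesgue_measure]_(x in `[0%R, pi]) (h x)%:E = (H pi - H 0)%:E)%E.
Proof.
move=> ch dH.
have cH x : {for x, continuous H}.
  apply/differentiable_continuous/derivable1_diffP.
  by have := dH x => ?; exact: ex_derive.
rewrite EFinB; apply: continuous_FTC2.
- exact: pi_gt0.
- exact: continuous_subspaceT.
- split.
  + by move=> x _; have := dH x => ?; exact: ex_derive.
  + by apply: cvg_at_right_filter; exact: cH.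
  + by apply: cvg_at_left_filter; exact: cH.
- by move=> x _; rewrite derive1E; have := dH x => ?; rewrite derive_val.
Qed.

Lemma integrable_0pi (R : realType) (h : R -> R) : continuous h ->
  lebesgue_measure.-integrable `[0, pi]%classic (fun x : R => (h x)%:E).
Proof.
move=> ch; apply: continuous_compact_integrable; first exact: segment_compact.
exact: continuous_subspaceT.
Qed.

Lemma continuous_exprf (R : realType) (h : R -> R) n : continuous h ->
  continuous (fun x => h x ^+ n).
Proof.
move=> ch x; apply: (@continuous_comp _ _ _ h (fun y => y ^+ n)); first exact: ch.
exact: exprn_continuous.
Qed.

(* Integrating [H' = a g - b h] with [H 0 = H pi] gives [a * A = b * B]. *)
Lemma reduction_0pi (R : realType) (H g h : R -> R) (a b A B : R) :
  continuous g -> continuous h -> H 0 = H pi ->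
  (forall x : R, is_derive x 1 H (a * g x - b * h x)) -> b != 0 ->
  (\int[lebesgue_measure]_(x in `[0%R, pi]) (g x)%:E = A%:E)%E ->
  a * A = b * B ->
  (\int[lebesgue_measure]_(x in `[0%R, pi]) (h x)%:E = B%:E)%E.
Proof.
move=> cg ch H0 dH b0 gA AB.
have cgh : continuous (fun x => a * g x - b * h x).
  by move=> x; apply: cvgB; apply: cvgMr; [exact: cg|exact: ch].
have := integral_0pi_derive cgh dH; rewrite H0 subrr.
under eq_integral do rewrite EFinB !EFinM.
have ig := integrable_0pi cg; have ih := integrable_0pi ch.
rewrite integralB//; [|exact: integrableZl..].
rewrite !integralZl// gA.
have : (\int[lebesgue_measure]_(x in `[0%R, pi]) (h x)%:E)%E \is a fin_num.
  exact: integrable_fin_num.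
case: (integral _ _ _) => // r _ /eqP.
rewrite -!EFinM -EFinB eqe subr_eq0 AB => /eqP/(mulfI b0) ->.
by [].
Qed.

Lemma integral_0pi_1 (R : realType) :
  (\int[lebesgue_measure]_(x in `[0%R, pi]) (1 : R)%:E = (pi : R)%:E)%E.
Proof.
have d (x : R) : is_derive x 1 (fun x : R => x) 1 by exact: is_derive_id.
by rewrite (integral_0pi_derive (fun x => @cst_continuous R R 1 x) d) subr0.
Qed.

(** With w = 1 - cos x, the derivative of w^n sin x is (2n+1) w^n - (n+1) w^(n+1), because (sin x)^2
    = w (2 - w). This yields the recursion of [BbarS]. *)
Lemma integral_0pi_1BcosX (R : realType) n :
  (\int[lebesgue_measure]_(x in `[0%R, pi]) ((1 - cos x) ^+ n)%:E =
   (pi * Bbar R n)%:E)%E.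
Proof.
have cc : continuous (fun x : R => 1 - cos x).
  by move=> x; apply: continuousB; [exact: cst_continuous|exact: continuous_cos].
elim: n => [|n IH].
  under eq_integral do rewrite expr0.
  by rewrite integral_0pi_1 Bbar0 mulr1.
apply: (@reduction_0pi R (fun x => (1 - cos x) ^+ n * sin x) (fun x => (1 - cos x) ^+ n)
  (fun x => (1 - cos x) ^+ n.+1) (n%:R * 2 + 1) (n%:R + 1) (pi * Bbar R n)).
- exact: continuous_exprf.
- exact: continuous_exprf.
- by rewrite sin0 sinpi !mulr0.
- move=> x.
  have d1 := is_derive_exprf n (is_derive_1Bcos x).
  have d2 := is_deriveM d1 (is_derive_sin x).
  apply: is_derive_eq d2 _.
  rewrite /GRing.scale/=; case: n {d1 IH} => [|n].
    by rewrite !expr0 expr1; ring.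
  rewrite /= !exprS -[n.+1%:R]natr1.
  have := cos2Dsin2 x.
  move: (cos x) (sin x) ((1 - cos x) ^+ n) => c s w cs.
  have -> : s * ((n%:R + 1) * w * s) = (n%:R + 1) * w * (1 - c ^+ 2).
    by rewrite -cs; ring.
  by ring.
- by rewrite gt_eqF// ltr_wpDl.
- exact: IH.
- rewrite BbarS; field; rewrite gt_eqF// ltr_wpDl//.
Qed.

(** Wallis's integrals: pi C(n, n/2) / 2^n for even n, in a form whose n! cancels against the
    exponential series. *)
Definition cos_moment (R : realType) n : R :=
  if odd n then 0 else pi * n`!%:R / (2 ^+ n * (n./2)`!%:R ^+ 2).

Lemma integral_0pi_cosX (R : realType) n :
  (\int[lebesgue_measure]_(x in `[0%R, pi]) (cos x ^+ n)%:E =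
   (cos_moment R n)%:E)%E.
Proof.
elim/ltn_ind: n => -[|[|n]] IH.
- under eq_integral do rewrite expr0.
  by rewrite integral_0pi_1 /cos_moment/= fact0 expr0 expr1n !mulr1 divr1.
- rewrite (@integral_0pi_derive R sin).
  + by rewrite sinpi sin0 subrr /cos_moment.
  + by apply: continuous_exprf; exact: continuous_cos.
(* The minus sign gives the derivative the required shape (n+1) cos^n - (n+2) cos^(n+2). *)
apply: (@reduction_0pi R (fun x => cos x ^+ n.+1 * - sin x) (fun x => cos x ^+ n)
  (fun x => cos x ^+ n.+2) n.+1%:R n.+2%:R (cos_moment R n)).
- by apply: continuous_exprf; exact: continuous_cos.
- by apply: continuous_exprf; exact: continuous_cos.
- by rewrite sin0 sinpi oppr0 !mulr0.
- move=> x.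
  have d1 := is_derive_exprf n.+1 (is_derive_cos x).
  have d2 := is_deriveM d1 (is_deriveN (is_derive_sin x)).
  apply: is_derive_eq d2 _.
  rewrite /GRing.scale/= !exprS -[n.+2%:R]natr1.
  rewrite [(- @sin R) x]/(- sin x).
  have := cos2Dsin2 x.
  move: (cos x) (sin x) (n.+1%:R : R) (cos x ^+ n) => c s m w cs.
  have -> : - s * (m * w * - s) = m * w * (1 - c ^+ 2) by rewrite -cs; ring.
  by ring.
- by rewrite pnatr_eq0.
- exact: IH.
- rewrite /cos_moment/= negbK; case: ifPn => [_|nodd]; first by rewrite !mulr0.
  rewrite !factS !natrM !exprS.
  have nE : n.+2%:R = 2 * (n./2.+1)%:R :> R.
    by rewrite -natrM mul2n doubleS; congr (_.+2%:R); rewrite even_halfK.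
  have F1 : n./2`!%:R != 0 :> R by rewrite pnatr_eq0 -lt0n fact_gt0.
  have F2 : n./2.+1%:R != 0 :> R by rewrite pnatr_eq0.
  have F3 : 2 ^+ n != 0 :> R by rewrite expf_neq0.
  rewrite nE; move: F1 F2 F3 => {IH nE}.
  move: (n./2`!%:R : R) (n./2.+1%:R : R) (2 ^+ n : R) (n.+1%:R : R) (n`!%:R : R) (pi : R).
  move=> a b c e f p a0 b0 c0.
  by field; rewrite a0 b0 c0.
Qed.

Lemma cos_moment_fact (R : realType) (t : R) k :
  t ^+ k.*2 / k.*2`!%:R * cos_moment R k.*2 =
  pi * ((t / 2) ^+ (2 * k) / k`!%:R ^+ 2).
Proof.
rewrite /cos_moment odd_double doubleK mul2n expr_div_n.
have F1 : k.*2`!%:R != 0 :> R by rewrite pnatr_eq0 -lt0n fact_gt0.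
have F2 : k`!%:R != 0 :> R by rewrite pnatr_eq0 -lt0n fact_gt0.
have F3 : 2 ^+ k.*2 != 0 :> R by rewrite expf_neq0.
by field; rewrite ?(F1, F2, F3).
Qed.

Lemma series_exp_coeff_le (R : realType) (x : R) n :
  `|series (exp_coeff x) n| <= expR `|x|.
Proof.
apply: (@le_trans _ _ (series (exp_coeff `|x|) n)).
  rewrite !seriesEnat/= (le_trans (ler_norm_sum _ _ _))//.
  apply: ler_sum => k _; rewrite /exp_coeff normrM normrX.
  by rewrite (@ger0_norm _ (_^-1)) ?invr_ge0.
apply: nondecreasing_cvgn_le; last exact: is_cvg_series_exp_coeff.
apply: nondecreasing_series => k _ _.
by rewrite /exp_coeff/= divr_ge0 ?exprn_ge0.
Qed.

(** The exponential series is integrated term by term, e^|t| dominating all its partial sums. *)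
Lemma bessel_integral (R : realType) (t : R) :
  (\int[lebesgue_measure]_(x in `[0%R, pi]) (expR (- t * cos x))%:E =
   (pi * besselI0 t)%:E)%E.
Proof.
have mcos : measurable_fun setT (@cos R).
  by apply: continuous_measurable_fun; exact: continuous_cos.
pose S N (x : R) := series (exp_coeff (- t * cos x)) N.
have cS N : continuous (S N).
  rewrite /S; elim: N => [|N IH] x.
    under eq_fun do rewrite seriesEnat/= big_nil.
    exact: cst_continuous.
  under eq_fun do rewrite seriesSr.
  apply: cvgD; first exact: IH.
  rewrite /exp_coeff/=; apply: cvgMl.
  apply: (@continuous_exprf _ (fun x => - t * cos x)) => {}x.
  by apply: cvgMr; exact: continuous_cos.
have intS N : (\int[lebesgue_measure]_(x in `[0%R, pi]) (S N x)%:E =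
    (\sum_(0 <= m < N) (- t) ^+ m / m`!%:R * cos_moment R m)%R%:E)%E.
  elim: N => [|N IH].
    rewrite big_nil; apply: integral0_eq => x _.
    by rewrite /S seriesEnat/= big_nil.
  rewrite big_nat_recr//= EFinD -IH EFinM -integral_0pi_cosX -integralZl//; last first.
    by apply: integrable_0pi; apply: continuous_exprf; exact: continuous_cos.
  rewrite -integralD//.
  - apply: eq_integral => x _; rewrite -EFinM -EFinD /S seriesSr; congr (_ + _)%:E.
    by rewrite /exp_coeff/= exprMn; ring.
  - exact: integrable_0pi.
  - apply: integrableZl => //.
    by apply: integrable_0pi; apply: continuous_exprf; exact: continuous_cos.
have cv : (\int[lebesgue_measure]_(x in `[0%R, pi]) (S N x)%:E)%E @[N --> \oo] -->
    (\int[lebesgue_measure]_(x in `[0%R, pi]) (expR (- t * cos x))%:E)%E.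
  apply: (@dominated_cvg _ _ _ _ _ _ _ _ (cst (expR `|t|)%:E)) => //.
  - by move=> n; apply/measurable_EFinP/measurable_funTS; exact: continuous_measurable_fun.
  - move=> x _; apply/fine_cvgP; split; first exact: nearW.
    exact: is_cvg_series_exp_coeff.
  - by apply: integrable_0pi; exact: cst_continuous.
  - move=> n x _; rewrite lee_fin (le_trans (series_exp_coeff_le _ _))//.
    rewrite ler_expR normrM normrN ler_piMr//.
    by rewrite ler_norml cos_geN1 cos_le1.
have cvR : (\sum_(0 <= m < N) (- t) ^+ m / m`!%:R * cos_moment R m) @[N --> \oo] -->
    fine (\int[lebesgue_measure]_(x in `[0%R, pi]) (expR (- t * cos x))%:E)%E.
  move: cv; under eq_fun do rewrite intS.
  rewrite -[X in _ --> X -> _]fineK; first by move=> /fine_cvgP[].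
  apply: integrable_fin_num => //; apply: integrable_0pi => x.
  apply: continuous_comp; last exact: continuous_expR.
  by apply: cvgMr; exact: continuous_cos.
(* Odd moments of the cosine vanish, so cutting off at even indices gives exactly the partial sums
   of the Bessel series. *)
have even K : \sum_(0 <= m < K.*2) (- t) ^+ m / m`!%:R * cos_moment R m =
    pi * series (fun k : nat => (t / 2) ^+ (2 * k) / (k`!)%:R ^+ 2) K.
  elim: K => [|K IH]; first by rewrite seriesEnat/= !big_nil mulr0.
  rewrite doubleS !big_nat_recr//= IH seriesSr mulrDr -addrA; congr (_ + _).
  rewrite -cos_moment_fact {2}/cos_moment/= odd_double mulr0 addr0.
  by rewrite exprNn -signr_odd odd_double mul1r.
have cvE : pi * series (fun k : nat => (t / 2) ^+ (2 * k) / (k`!)%:R ^+ 2) K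
    @[K --> \oo] -->
    fine (\int[lebesgue_measure]_(x in `[0%R, pi]) (expR (- t * cos x))%:E)%E.
  under eq_fun do rewrite -even.
  apply: (cvg_comp _ _ _ cvR).
  move=> A [N _ hN]; exists N => // K /= NK; apply: hN => /=.
  by rewrite (leq_trans NK)// -addnn leq_addr.
have pi0 : pi != 0 :> R by rewrite gt_eqF// pi_gt0.
have cvB : series (fun k : nat => (t / 2) ^+ (2 * k) / (k`!)%:R ^+ 2) @ \oo -->
    pi^-1 * fine (\int[lebesgue_measure]_(x in `[0%R, pi]) (expR (- t * cos x))%:E)%E.
  have : pi^-1 * (pi * series (fun k : nat => (t / 2) ^+ (2 * k) / (k`!)%:R ^+ 2) K)
      @[K --> \oo] --> pi^-1 *
      fine (\int[lebesgue_measure]_(x in `[0%R, pi]) (expR (- t * cos x))%:E)%E.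
    exact: cvgMr cvE.
  by under eq_fun do rewrite mulKf//.
rewrite /besselI0 (cvg_lim _ cvB)// mulVKf// fineK//.
apply: integrable_fin_num => //; apply: integrable_0pi => x.
apply: continuous_comp; last exact: continuous_expR.
by apply: cvgMr; exact: continuous_cos.
Qed.

Lemma arcsine_measure_moments (R : realType)
    (nu : {measure set (measurableTypeR R) -> \bar R}) :
  (forall A, measurable A ->
    nu A = \int[lebesgue_measure]_(y in A) (arcsine_density y)%:E)%E ->
  forall n, (\int[nu]_x (x ^+ n)%:E = (Bbar R n)%:E)%E.
Proof.
move=> nuE n.
have mX : measurable_fun setT (fun x : measurableTypeR R => (x ^+ n)%:E).
  by apply/measurable_EFinP; exact: exprn_measurable.
have cA : continuous (fun x : R => `|x| ^+ n).
  by apply: continuous_exprf; exact: norm_continuous.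
have mA : measurable_fun setT (fun x : measurableTypeR R => (`|x| ^+ n)%:E).
  by apply/measurable_EFinP; exact: continuous_measurable_fun.
have mI : measurable (`]0, 2[%classic : set (measurableTypeR R)).
  exact: measurable_itv.
have n0 : nu (~` `]0, 2[%classic) = 0%E.
  rewrite nuE; last exact: measurableC.
  apply: integral0_eq => x /= /negP; rewrite in_itv/= => /negbTE h.
  by rewrite /arcsine_density h.
have IE (f : measurableTypeR R -> \bar R) : measurable_fun setT f ->
    (\int[nu]_x f x = \int[nu]_(x in `]0%R, 2%R[) f x)%E.
  by move=> mf; apply: eq_integral_null_sets; rewrite ?setTD ?setDT ?measure0.
(* [arcsine_integral] asks for an integrand nonnegative on the whole line; the absolute value
   changes nothing on ]0, 2[, which carries [nu]. *)
transitivity (\int[nu]_x (`|x| ^+ n)%:E)%E.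
  rewrite (IE _ mX) (IE _ mA); apply: eq_integral => x.
  by rewrite inE/= in_itv/= => /andP[x0 _]; rewrite gtr0_norm.
rewrite (@ge0_integral_density _ (measurableTypeR R) R lebesgue_measure nu _
  (@measurable_arcsine_density R) (@arcsine_density_ge0 R) nuE _ mA);
  last by move=> x; rewrite lee_fin exprn_ge0.
rewrite (@arcsine_integral R (fun x => `|x| ^+ n) cA); last first.
  by move=> x; rewrite exprn_ge0.
transitivity ((pi^-1)%:E * \int[@lebesgue_measure R]_(x in `[0%R, pi])
    ((1 - cos x) ^+ n)%:E)%E.
  congr (_ * _)%E; apply: eq_integral => x _.
  by rewrite ger0_norm// subr_ge0 cos_le1.
by rewrite integral_0pi_1BcosX -EFinM mulKf// gt_eqF// pi_gt0.
Qed.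

(** * The central binomial moment sequence *)

Lemma stieltjes_moments_setT (R : realType)
    (mu : {measure set (measurableTypeR R) -> \bar R}) (m : nat -> R) :
  has_stieltjes_moments mu m -> forall n, (\int[mu]_x (x ^+ n)%:E = (m n)%:E)%E.
Proof.
move=> [mu0 mE] n; rewrite -mE; apply: eq_integral_null_sets => //.
- by apply/measurable_EFinP; exact: exprn_measurable.
- by rewrite setTD.
- by rewrite setDT measure0.
Qed.

Lemma stieltjes_unique (R : realType) (K : R) (m : nat -> R)
    (mu nu : {measure set (measurableTypeR R) -> \bar R}) : 0 < K ->
  (forall n, m n <= K ^+ n) ->
  has_stieltjes_moments mu m -> has_stieltjes_moments nu m ->
  forall A, measurable A -> mu A = nu A.
Proof.
move=> K0 mK /stieltjes_moments_setT hmu /stieltjes_moments_setT hnu.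
by apply: (moment_determinacy K0 hmu hnu) => n; exact: mK.
Qed.

Lemma Bbar_powR_le (R : realType) (c : R) n : 0 < c ->
  Bbar R n `^ c <= (2 `^ c) ^+ n.
Proof.
move=> c0; rewrite -powR_mulrn ?powR_ge0// -powRrM mulrC powRrM powR_mulrn//.
by apply: ge0_ler_powR; rewrite ?nnegrE ?(ltW c0) ?exprn_ge0 ?Bbar_le// ltW ?Bbar_gt0.
Qed.

(** |y^n| <= 1 + y^(2n), and the moment of order 2n is finite. *)
Lemma integrable_moment d (T : measurableType d) (R : realType)
    (P : probability T R) (Y : {RV P >-> R}) (m : nat -> R) n :
  has_moment_sequence Y m -> P.-integrable setT (fun w => (Y w ^+ n)%:E).
Proof.
move=> hY; have mY : measurable_fun setT Y by [].
have mX k : measurable_fun setT (fun w => (Y w ^+ k)%:E).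
  by apply/measurable_EFinP; exact: measurable_funX.
apply/integrableP; split; first exact: mX.
apply: (@le_lt_trans _ _ (\int[P]_w ((1 : R)%:E + (Y w ^+ n.*2)%:E))%E).
  apply: ge0_le_integral => //.
  - by apply: measurableT_comp.
  - by apply: emeasurable_funD.
  move=> x _; rewrite -EFinD lee_fin -mul2n mulnC exprM -real_normK ?num_real//.
  by have := sqr_ge0 (`|Y x ^+ n| - 1); have := normr_ge0 (Y x ^+ n); nra.
rewrite ge0_integralD//; last first.
  by move=> x _; rewrite lee_fin exprn_even_ge0// odd_double.
have := hY n.*2; rewrite unlock => ->.
rewrite integral_cst// mul1e.
apply: lte_add_pinfty; last exact: ltry.
exact: le_lt_trans (probability_le1 P measurableT) (ltry _).
Qed.

(* The law of [Y] restated on [measurableTypeR R], whose display differs from that of the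
   canonical measurable structure on [R] used by [distribution]. *)
Lemma law_measure d (T : measurableType d) (R : realType)
    (P : probability T R) (Y : {RV P >-> R}) :
  exists mu : {measure set (measurableTypeR R) -> \bar R},
  [/\ forall A, mu A = distribution P Y A,
      forall f : measurableTypeR R -> \bar R, measurable_fun setT f ->
        (forall y, 0 <= f y)%E -> (\int[mu]_y f y = \int[P]_w f (Y w))%E &
      forall f : measurableTypeR R -> \bar R, measurable_fun setT f ->
        P.-integrable setT (fun w => f (Y w)) ->
        (\int[mu]_y f y = \int[P]_w f (Y w))%E].
Proof.
pose Z : T -> measurableTypeR R := Y.
have mZ : measurable_fun setT Z by exact: (measurable_funPT Y).
exists (pushforward P Z); split.
- by move=> A.
- by move=> f mf f0; rewrite ge0_integral_pushforward//.
- by move=> f mf fi; rewrite integral_pushforward//.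
Unshelve. all: exact: mZ.
Qed.

(** [Y] is not assumed nonnegative, so its law is identified by determinacy on the whole line, with
    K = 2 from [Bbar_le]. *)
Lemma arcsine_distribution d (T : measurableType d) (R : realType)
    (P : probability T R) (Y : {RV P >-> R}) :
  has_moment_sequence Y (Bbar R) -> has_density Y (@arcsine_density R).
Proof.
move=> hY; split.
- exact: measurable_arcsine_density.
- exact: arcsine_density_ge0.
have [nu nuE] := density_measure (@lebesgue_measure R)
  (@measurable_arcsine_density R) (@arcsine_density_ge0 R).
move=> A mA; rewrite -nuE//.
have [mu [muE _ muI]] := law_measure Y.
rewrite -muE; apply: (@moment_determinacy R mu nu 2 (Bbar R)) => //.
- move=> n; rewrite muI; last exact: (integrable_moment n hY).
    by have := hY n; rewrite unlock.
  by apply/measurable_EFinP; exact: exprn_measurable.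
- exact: arcsine_measure_moments.
- by move=> n; exact: Bbar_le.
Qed.

Lemma arcsine_mmt_gen_fun d (T : measurableType d) (R : realType)
    (P : probability T R) (Y : {RV P >-> R}) (t : R) :
  has_density Y (@arcsine_density R) -> 'M_P Y t = (expR t * besselI0 t)%:E.
Proof.
move=> [mf f0 hd].
have cE : continuous (fun x : R => expR (x * t)).
  move=> x; apply: continuous_comp; last exact: continuous_expR.
  exact: cvgMl.
have mE : measurable_fun setT (fun x : measurableTypeR R => (expR (x * t))%:E).
  by apply/measurable_EFinP; exact: continuous_measurable_fun.
have [mu [muE muI _]] := law_measure Y.
transitivity (\int[mu]_x (expR (x * t))%:E)%E.
  rewrite muI//.
  by rewrite /mmt_gen_fun unlock.
have muD A : measurable A -> mu A =
    (\int[lebesgue_measure]_(y in A) (arcsine_density y)%:E)%E.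
  by rewrite muE; exact: hd.
rewrite (@ge0_integral_density _ (measurableTypeR R) R lebesgue_measure mu _
  mf f0 muD _ mE); last by move=> x; rewrite lee_fin expR_ge0.
rewrite (arcsine_integral cE); last by move=> x; rewrite expR_ge0.
(* At y = 1 - cos x the exponential e^(ty) splits off the factor e^t. *)
transitivity ((pi^-1)%:E * \int[@lebesgue_measure R]_(x in `[0%R, pi])
    ((expR t)%:E * (expR (- t * cos x))%:E))%E.
  congr (_ * _)%E; apply: eq_integral => x _.
  by rewrite -EFinM -expRD; congr (expR _)%:E; ring.
rewrite ge0_integralZl//; last first.
  apply/measurable_EFinP/measurable_funTS; apply: continuous_measurable_fun => x.
  apply: continuous_comp; last exact: continuous_expR.
  by apply: cvgMr; exact: continuous_cos.
rewrite bessel_integral -!EFinM; congr EFin.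
by rewrite mulrCA mulKf// gt_eqF// pi_gt0.
Qed.

Lemma Bbar_powR_stieltjes (R : realType) (c : R) : 0 < c ->
  stieltjes_moment_sequence (fun n => Bbar R n `^ c).
Proof.
move=> c0; have [mu [mu0 muE]] := Bbar_mellin_measure c0.
by exists mu; exact: mellin_stieltjes_moments.
Qed.

Unset Implicit Arguments.

Theorem mainTheorem3 (R : realType) :
  [/\ (* (a) *)
      infinitely_divisible_stieltjes (Bbar R),
      (* (b) *)
      forall (d : measure_display) (T : measurableType d)
          (P : probability T R) (Y : {RV P >-> R}),
        has_moment_sequence Y (Bbar R) ->
        has_density Y (@arcsine_density R) /\
        forall t : R, 'M_P Y t = (expR t * besselI0 t)%:E,
      (* (c) *)
      forall c : R, 0 < c -> stieltjes_determinate (fun n => Bbar R n `^ c) &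
      (* (d) *)
      forall c : R, 0 < c ->
      forall mu : {measure set (measurableTypeR R) -> \bar R},
        has_stieltjes_moments mu (fun n => Bbar R n `^ c) ->
      forall s : R, 0 <= s ->
        (\int[mu]_(t in `[0%R, +oo[) (t `^ s)%:E)%E =
          ((2 `^ s / Num.sqrt pi * (Gamma (s + 1 / 2) / Gamma (s + 1))) `^ c)%:E
        /\
        (2 `^ s / Num.sqrt pi * (Gamma (s + 1 / 2) / Gamma (s + 1))) `^ c =
          (1 / 2 `^ s * (Gamma (2 * s + 1) / Gamma (s + 1) ^+ 2)) `^ c ].
Proof.
split.
- split; last by move=> c; exact: Bbar_powR_stieltjes.
  have := @Bbar_powR_stieltjes R 1 ltr01.
  by under eq_fun do rewrite powRr1 ?(ltW (Bbar_gt0 _ _))//.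
- move=> d T P Y hY; have hd := arcsine_distribution hY; split => // t.
  exact: arcsine_mmt_gen_fun.
- move=> c c0; split; first exact: Bbar_powR_stieltjes.
  move=> mu nu; apply: (@stieltjes_unique R (2 `^ c)); first exact: powR_gt0.
  by move=> n; exact: Bbar_powR_le.
- move=> c c0 mu hmu s s0; split; last by rewrite Gamma_duplication.
  (* [mu] is given through its integer moments alone; determinacy identifies it with [nu], whose
     Mellin transform is known at every real s >= 0. *)
  have [nu [nu0 nuE]] := Bbar_mellin_measure c0.
  rewrite -nuE//; apply: eq_measure_integral => A mA _.
  apply: (@stieltjes_unique R (2 `^ c) (fun n => Bbar R n `^ c)) => //.
  + by move=> n; exact: Bbar_powR_le.
  + exact: mellin_stieltjes_moments.
Qed.
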